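(* Let $n\ge2$, $k\ge1$, let $M^n\hookrightarrow\mathbb R^{n+k}$ be an embedded submanifold, $v$ a vector field on $M$, $p\in M$, with $v$ extended to a neighborhood of $p$ in $\mathbb R^{n+k}$ (still denoted $v$). Then, evaluating at $p$, the following hold: $$\tilde\nabla^*\tilde\nabla v=\nabla^*\nabla v+\sum_{l=1}^kW_{N_l}W_{N_l}v-nW_{\mathbf H}v+n[\mathbf H,v]-\sum_{l=1}^k\tilde\nabla_{N_l}\tilde\nabla_{N_l}v+\sum_{l=1}^k\tilde\nabla_{\tilde\nabla_{N_l}N_l}v-2\delta^{ij}\mathrm{II}(E_i,\nabla_{E_j}v),$$ $$\tilde\nabla^*\tilde\nabla v=\nabla^*\nabla v-\mathrm{Ric}\,v+n[\mathbf H,v]-\sum_{l=1}^k\tilde\nabla_{N_l}\tilde\nabla_{N_l}v+\sum_{l=1}^k\tilde\nabla_{\tilde\nabla_{N_l}N_l}v-2\delta^{ij}\mathrm{II}(E_i,\nabla_{E_j}v),$$ $$\tilde\nabla^*\tilde\nabla v=\nabla^*\nabla v+\sum_{l=1}^kW_{N_l}W_{N_l}v+n\tilde\nabla_{\mathbf H}v-\sum_{l=1}^k\tilde\nabla_{N_l}\tilde\nabla_{N_l}v+\sum_{l=1}^k\tilde\nabla_{\tilde\nabla_{N_l}N_l}v-(\operatorname{tr}\nabla^B\mathrm{II})(v)-2\delta^{ij}\mathrm{II}(E_i,\nabla_{E_j}v),$$ $$\tilde\nabla^*\tilde\nabla v=\nabla^*\nabla v-\mathrm{Ric}\,v+nW_{\mathbf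 H}v+n\tilde\nabla_{\mathbf H}v-\sum_{l=1}^k\tilde\nabla_{N_l}\tilde\nabla_{N_l}v+\sum_{l=1}^k\tilde\nabla_{\tilde\nabla_{N_l}N_l}v-(\operatorname{tr}\nabla^B\mathrm{II})(v)-2\delta^{ij}\mathrm{II}(E_i,\nabla_{E_j}v).$$ In the case of a hypersurface $M\hookrightarrow\mathbb R^{n+1}$: $$\tilde\nabla^*\tilde\nabla v=\nabla^*\nabla v+s^2v+nH\tilde\nabla_Nv-\tilde\nabla_N\tilde\nabla_Nv+\nabla_{\tilde\nabla_NN}v-\Big(2\sum_i\kappa_i\nabla_iv^i+nv(H)-h(v,\tilde\nabla_NN)\Big)N,$$ $$\tilde\nabla^*\tilde\nabla v=\nabla^*\nabla v-\mathrm{Ric}\,v+nH[N,v]-\tilde\nabla_N\tilde\nabla_Nv+\nabla_{\tilde\nabla_NN}v-\Big(2\sum_i\kappa_i\nabla_iv^i+nv(H)-h(v,\tilde\nabla_NN)\Big)N,$$ $$\tilde\nabla^*\tilde\nabla v=\nabla^*\nabla v+s^2v+nH\tilde\nabla_Nv-\tilde\nabla_N\tilde\nabla_Nv+\nabla_{\tilde\nabla_NN}v-\Big((\operatorname{div}h)(v)+2\sum_i\kappa_i\nabla_iv^i-h(\tilde\nabla_NN,v)\Big)N,$$ $$\tilde\nabla^*\tilde\nabla v=\nabla^*\nabla v-\mathrm{Ric}\,v+nH[N,v]-\tilde\nabla_N\tilde\nabla_Nv+\nabla_{\tilde\nabla_NN}v-\Big((\operatorname{div}h)(v)+2\sum_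i\kappa_i\nabla_iv^i-h(v,\tilde\nabla_NN)\Big)N.$$
   Context: Everything is smooth. $\tilde g$ and $\tilde\nabla$ are the Euclidean metric and connection; $M$ carries the induced metric $g$ with Levi-Civita connection $\nabla$. ${}^T,{}^\perp$ are orthogonal projections onto $T_pM$ and $(T_pM)^\perp$. Frames: $E_1,\dots,E_n$ is a local orthonormal (ON) frame on $M$ near $p$, $N_1,\dots,N_k$ a local ON frame of the normal bundle, extended so that together they form an ON frame in a neighborhood of $p$ in the ambient space. For $k=1$, $N=N_1$ is a choice of unit normal and the $E_i$ at $p$ are eigenvectors of the shape operator. Indices $i,j$ run over $1,\dots,n$; repeated indices are summed. $\mathrm{II}(X,Y)=(\tilde\nabla_XY)^\perp$; for a normal field $\eta$, $g(W_\eta X,Y)=\tilde g(\eta,\mathrm{II}(X,Y))$, i.e. $W_\eta X=-(\tilde\nabla_X\eta)^T$; $\mathbf H=\frac1n\delta^{ij}\mathrm{II}(E_i,E_j)$ (extended to a neighborhood of $p$ in $[\mathbf H,v]$); $\nabla^\perp_X\eta=(\tilde\nabla_X\eta)^\perp$; for normal-bundle-valued bilinear maps $A$ on $TM$, $(\nabla^B_XA)(Y,Z)=\nabla^\perp_X(A(Y,Z))-A(\nabla_XY,Z)-A(Y,\nabla_XZ)$; $(\operatorname{tr}\nabla^B\mathrm{II})(v)=\delta^{ij}(\nabla^B_{E_i}\mathrm{II})(E_j,v)$. For $k=1$: $h(X,Y)=\tilde g(N,\mathrm{II}(X,Y))$; $g(sX,Y)=h(X,Y)$, so $sX=-\tilde\nabla_XN$;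 $sE_i=\kappa_iE_i$ at $p$ (principal curvatures); $H=\frac1n\sum_i\kappa_i$, so $\mathbf H=HN$; $(\operatorname{div}h)(v)=\sum_i(\nabla_{E_i}h)(E_i,v)$. $\nabla_iv^j=E_i(v^j)+\Gamma^j_{ik}v^k$ with $\nabla_{E_i}E_k=\Gamma_{ik}^jE_j$, so $\nabla_iv^i$ (fixed $i$) is $g(\nabla_{E_i}v,E_i)$. Bochner Laplacian with respect to a Levi-Civita connection $D$ and local ON frame $\{F_a\}$: $D^*Dv=-\sum_a(D_{F_a}D_{F_a}v-D_{D_{F_a}F_a}v)$; $\nabla^*\nabla$ is on $M$, $\tilde\nabla^*\tilde\nabla$ on the Euclidean space. $\mathrm{Ric}\,v=\mathrm{Ric}(v,\cdot)^\sharp$, with $\mathrm{Ric}(X,Y)=\sum_iR(E_i,X,Y,E_i)$ the Ricci tensor of $M$, $R(W,X,Y,Z)=g(\nabla_W\nabla_XY-\nabla_X\nabla_WY-\nabla_{[W,X]}Y,Z)$. *)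

(* Defs.v *)
From HB Require Import structures.
From mathcomp Require Import all_boot all_order all_algebra.
From mathcomp Require Import all_classical all_reals all_analysis.

Set Implicit Arguments.
Unset Strict Implicit.
Unset Printing Implicit Defensive.

Import Order.TTheory GRing.Theory Num.Theory.
Import numFieldNormedType.Exports.

Local Open Scope classical_set_scope.
Local Open Scope ring_scope.

(* The topology of 'rV[R]_m is given by the sup norm, which is equivalent to
   the Euclidean one; the Euclidean metric itself is [inner]. *)
Definition inner (R : realType) (m : nat) (u w : 'rV[R]_m) : R :=
  \sum_(i < m) u 0 i * w 0 i.

Definition orthonormal (R : realType) (m : nat) (I : eqType)
    (e : I -> 'rV[R]_m) : Prop :=
  forall a b : I, inner (e a) (e b) = (a == b)%:R.

Fixpoint Ck_on (R : realType) (V W : normedModType R) (r : nat) (U : set V)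
    (f : V -> W) {struct r} : Prop :=
  match r with
  | 0%N => forall x, U x -> {for x, continuous f}
  | r'.+1 => (forall x, U x -> differentiable f x) /\
             (forall w : V, Ck_on r' U (fun x => 'D_w f x))
  end.

Definition smooth_on (R : realType) (V W : normedModType R) (U : set V)
    (f : V -> W) : Prop := forall r : nat, Ck_on r U f.

(* Every point of M lies in the domain of a smooth slice chart
   phi : U -> V, with smooth inverse psi : V -> U, taking M `&` U onto
   V intersected with R^n x {0}. *)
Definition embedded_submanifold (R : realType) (n k : nat)
    (M : set 'rV[R]_(n + k)) : Prop :=
  forall q, M q ->
  exists (U V : set 'rV[R]_(n + k)) (phi psi : 'rV[R]_(n + k) -> 'rV[R]_(n + k)),
    [/\ [/\ open U, open V & U q],
        smooth_on U phi /\ smooth_on V psi,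
        forall x, U x -> V (phi x) /\ psi (phi x) = x,
        forall y, V y -> U (psi y) /\ phi (psi y) = y &
        forall x, U x -> (M x <-> rsubmx (phi x) = 0)].

(* A smooth curve in M through q = c(0) with velocity w = c'(0). *)
Definition curve_through (R : realType) (m : nat) (M : set 'rV[R]_m)
    (q w : 'rV[R]_m) (c : R -> 'rV[R]_m) : Prop :=
  [/\ c 0 = q, derive1 c 0 = w &
      exists J : set R, [/\ open J, J 0,
        smooth_on (V := R^o) J c & forall t, J t -> M (c t)]].

Definition tangent (R : realType) (m : nat) (M : set 'rV[R]_m)
    (q w : 'rV[R]_m) : Prop := exists c, curve_through M q w c.

Definition tproj (R : realType) (m : nat) (M : set 'rV[R]_m)
    (q u : 'rV[R]_m) : 'rV[R]_m :=
  xget 0 [set w | tangent M q w /\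
                  forall t, tangent M q t -> inner (u - w) t = 0].

Definition nproj (R : realType) (m : nat) (M : set 'rV[R]_m)
    (q u : 'rV[R]_m) : 'rV[R]_m := u - tproj M q u.

(* Fields along M are represented by total functions on the ambient space of
   which only the values on M matter; smoothness on M `&` U means existence of
   local smooth extensions to the ambient space. *)
Definition smooth_along (R : realType) (m : nat) (W : normedModType R)
    (M U : set 'rV[R]_m) (f : 'rV[R]_m -> W) : Prop :=
  forall q, M q -> U q ->
  exists (O : set 'rV[R]_m) (g : 'rV[R]_m -> W),
    [/\ open O, O q, smooth_on O g & forall x, M x -> O x -> f x = g x].

Definition vector_field (R : realType) (m : nat) (M U : set 'rV[R]_m)
    (X : 'rV[R]_m -> 'rV[R]_m) : Prop :=
  smooth_along M U X /\ forall q, M q -> U q -> tangent M q (X q).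

(* Derivative at q, in the direction w tangent to M, of a function f defined
   along M: the derivative of f along a curve in M with velocity w.  For f
   smooth along M it does not depend on the curve, and it is 'D_w g q for any
   smooth extension g of f.  For vector-valued f it is thus the Euclidean
   connection of the ambient space, applied to a field along M. *)
Definition dalong (R : realType) (m : nat) (W : normedModType R)
    (M : set 'rV[R]_m) (f : 'rV[R]_m -> W) (q w : 'rV[R]_m) : W :=
  derive1 (f \o xget (cst q) [set c | curve_through M q w c]) 0.

(* Euclidean connection and Lie bracket of the ambient space. *)
Definition flat (R : realType) (m : nat) (X Y : 'rV[R]_m -> 'rV[R]_m)
    (q : 'rV[R]_m) : 'rV[R]_m := 'D_(X q) Y q.
Arguments flat {R m} X Y q.

Definition bracket (R : realType) (m : nat) (X Y : 'rV[R]_m -> 'rV[R]_m)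
    (q : 'rV[R]_m) : 'rV[R]_m := 'D_(X q) Y q - 'D_(Y q) X q.

(* Bracket of two fields tangent to M. *)
Definition mbracket (R : realType) (m : nat) (M : set 'rV[R]_m)
    (X Y : 'rV[R]_m -> 'rV[R]_m) (q : 'rV[R]_m) : 'rV[R]_m :=
  dalong M Y q (X q) - dalong M X q (Y q).

(* Levi-Civita connection of M with the induced metric.  It acts on fields
   defined on arbitrary relatively open subsets M `&` U of M. *)
Record levi_civita (R : realType) (m : nat) (M : set 'rV[R]_m)
    (D : ('rV[R]_m -> 'rV[R]_m) -> ('rV[R]_m -> 'rV[R]_m) ->
         'rV[R]_m -> 'rV[R]_m) : Prop := LeviCivita {
  lc_field : forall U X Y, open U -> vector_field M U X ->
    vector_field M U Y -> vector_field M U (D X Y);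
  lc_addl : forall U X X' Y q, open U -> vector_field M U X ->
    vector_field M U X' -> vector_field M U Y -> M q -> U q ->
    D (fun x => X x + X' x) Y q = D X Y q + D X' Y q;
  lc_scalel : forall U (f : 'rV[R]_m -> R^o) X Y q, open U ->
    smooth_along M U f -> vector_field M U X -> vector_field M U Y ->
    M q -> U q ->
    D (fun x => f x *: X x) Y q = f q *: D X Y q;
  lc_addr : forall U X Y Y' q, open U -> vector_field M U X ->
    vector_field M U Y -> vector_field M U Y' -> M q -> U q ->
    D X (fun x => Y x + Y' x) q = D X Y q + D X Y' q;
  lc_leibniz : forall U (f : 'rV[R]_m -> R^o) X Y q, open U ->
    smooth_along M U f -> vector_field M U X -> vector_field M U Y ->
    M q -> U q ->
    D X (fun x => f x *: Y x) q =
      (dalong M f q (X q) : R) *: Y q + f q *: D X Y q;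
  lc_metric : forall U X Y Z q, open U -> vector_field M U X ->
    vector_field M U Y -> vector_field M U Z -> M q -> U q ->
    dalong (W := R^o) M (fun x => inner (Y x) (Z x)) q (X q) =
      inner (D X Y q) (Z q) + inner (Y q) (D X Z q);
  lc_torsion_free : forall U X Y q, open U -> vector_field M U X ->
    vector_field M U Y -> M q -> U q ->
    D X Y q - D Y X q = mbracket M X Y q
}.

Definition join_frame (R : realType) (m n k : nat)
    (E : 'I_n -> 'rV[R]_m -> 'rV[R]_m) (N : 'I_k -> 'rV[R]_m -> 'rV[R]_m)
    (q : 'rV[R]_m) (a : 'I_n + 'I_k) : 'rV[R]_m :=
  match a with inl i => E i q | inr l => N l q end.

(* On the ambient open set U: a smooth orthonormal frame E_1..E_n, N_1..N_k
   which along M consists of tangent fields E_i and normal fields N_l. *)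
Record adapted_frame (R : realType) (m n k : nat) (M U : set 'rV[R]_m)
    (E : 'I_n -> 'rV[R]_m -> 'rV[R]_m)
    (N : 'I_k -> 'rV[R]_m -> 'rV[R]_m) : Prop := AdaptedFrame {
  af_smoothE : forall i, smooth_on U (E i);
  af_smoothN : forall l, smooth_on U (N l);
  af_orthonormal : forall q, U q -> orthonormal (join_frame E N q);
  af_tangent : forall i q, M q -> U q -> tangent M q (E i q);
  af_normal : forall l q, M q -> U q ->
    forall w, tangent M q w -> inner (N l q) w = 0
}.

Definition ambient_frame (R : realType) (m : nat) (U : set 'rV[R]_m)
    (F : 'I_m -> 'rV[R]_m -> 'rV[R]_m) : Prop :=
  (forall a, smooth_on U (F a)) /\
  (forall q, U q -> orthonormal (fun a => F a q)).

Definition tangent_frame (R : realType) (m n : nat) (M U : set 'rV[R]_m)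
    (G : 'I_n -> 'rV[R]_m -> 'rV[R]_m) : Prop :=
  (forall i, vector_field M U (G i)) /\
  (forall q, M q -> U q -> orthonormal (fun i => G i q)).

(* The Bochner Laplacian D^*D v, computed in an orthonormal frame F (on which
   the value does not depend). *)
Definition bochner (R : realType) (m d : nat)
    (D : ('rV[R]_m -> 'rV[R]_m) -> ('rV[R]_m -> 'rV[R]_m) ->
         'rV[R]_m -> 'rV[R]_m)
    (F : 'I_d -> 'rV[R]_m -> 'rV[R]_m) (v : 'rV[R]_m -> 'rV[R]_m)
    (q : 'rV[R]_m) : 'rV[R]_m :=
  - \sum_(a < d) (D (F a) (D (F a) v) q - D (D (F a) (F a)) v q).

Definition second_ff (R : realType) (m : nat) (M : set 'rV[R]_m)
    (X Y : 'rV[R]_m -> 'rV[R]_m) (q : 'rV[R]_m) : 'rV[R]_m :=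
  nproj M q (dalong M Y q (X q)).

(* W_eta w at q, for a normal field eta and w tangent to M at q. *)
Definition weingarten (R : realType) (m : nat) (M : set 'rV[R]_m)
    (eta : 'rV[R]_m -> 'rV[R]_m) (q w : 'rV[R]_m) : 'rV[R]_m :=
  - tproj M q (dalong M eta q w).

Definition mean_curvature_vector (R : realType) (m n : nat)
    (M : set 'rV[R]_m) (E : 'I_n -> 'rV[R]_m -> 'rV[R]_m)
    (q : 'rV[R]_m) : 'rV[R]_m :=
  n%:R^-1 *: \sum_(i < n) second_ff M (E i) (E i) q.

Definition normal_connection (R : realType) (m : nat) (M : set 'rV[R]_m)
    (X eta : 'rV[R]_m -> 'rV[R]_m) (q : 'rV[R]_m) : 'rV[R]_m :=
  nproj M q (dalong M eta q (X q)).

Definition nablaB (R : realType) (m : nat) (M : set 'rV[R]_m)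
    (D A : ('rV[R]_m -> 'rV[R]_m) -> ('rV[R]_m -> 'rV[R]_m) ->
         'rV[R]_m -> 'rV[R]_m)
    (X Y Z : 'rV[R]_m -> 'rV[R]_m) (q : 'rV[R]_m) : 'rV[R]_m :=
  normal_connection M X (A Y Z) q - A (D X Y) Z q - A Y (D X Z) q.

Definition tr_nablaB_II (R : realType) (m n : nat) (M : set 'rV[R]_m)
    (D : ('rV[R]_m -> 'rV[R]_m) -> ('rV[R]_m -> 'rV[R]_m) ->
         'rV[R]_m -> 'rV[R]_m)
    (E : 'I_n -> 'rV[R]_m -> 'rV[R]_m) (v : 'rV[R]_m -> 'rV[R]_m)
    (q : 'rV[R]_m) : 'rV[R]_m :=
  \sum_(i < n) nablaB M D (second_ff M) (E i) (E i) v q.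

Definition riemann (R : realType) (m : nat) (M : set 'rV[R]_m)
    (D : ('rV[R]_m -> 'rV[R]_m) -> ('rV[R]_m -> 'rV[R]_m) ->
         'rV[R]_m -> 'rV[R]_m)
    (W X Y Z : 'rV[R]_m -> 'rV[R]_m) (q : 'rV[R]_m) : R :=
  inner (D W (D X Y) q - D X (D W Y) q - D (mbracket M W X) Y q) (Z q).

Definition ricci (R : realType) (m n : nat) (M : set 'rV[R]_m)
    (D : ('rV[R]_m -> 'rV[R]_m) -> ('rV[R]_m -> 'rV[R]_m) ->
         'rV[R]_m -> 'rV[R]_m)
    (E : 'I_n -> 'rV[R]_m -> 'rV[R]_m) (X Y : 'rV[R]_m -> 'rV[R]_m)
    (q : 'rV[R]_m) : R :=
  \sum_(i < n) riemann M D (E i) X Y (E i) q.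

(* The vector dual to Ric(v, .), whose components in the orthonormal frame E
   are Ric(v, E_j). *)
Definition ricci_sharp (R : realType) (m n : nat) (M : set 'rV[R]_m)
    (D : ('rV[R]_m -> 'rV[R]_m) -> ('rV[R]_m -> 'rV[R]_m) ->
         'rV[R]_m -> 'rV[R]_m)
    (E : 'I_n -> 'rV[R]_m -> 'rV[R]_m) (v : 'rV[R]_m -> 'rV[R]_m)
    (q : 'rV[R]_m) : 'rV[R]_m :=
  \sum_(j < n) ricci M D E v (E j) q *: E j q.

(* In what follows M is a hypersurface and nu a unit normal field. *)
Definition scalar_ff (R : realType) (m : nat) (M : set 'rV[R]_m)
    (nu X Y : 'rV[R]_m -> 'rV[R]_m) (q : 'rV[R]_m) : R :=
  inner (nu q) (second_ff M X Y q).

(* k_1..k_n are the eigenvalues of the shape operator s = W_nu at q, with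
   respect to some orthonormal eigenbasis of T_q M. *)
Definition principal_curvatures (R : realType) (m n : nat)
    (M : set 'rV[R]_m) (nu : 'rV[R]_m -> 'rV[R]_m) (q : 'rV[R]_m)
    (k : 'I_n -> R) : Prop :=
  exists e : 'I_n -> 'rV[R]_m,
    [/\ orthonormal e, forall i, tangent M q (e i) &
        forall i, weingarten M nu q (e i) = k i *: e i].

Definition mean_curvature (R : realType) (m n : nat)
    (kappa : 'rV[R]_m -> 'I_n -> R) (q : 'rV[R]_m) : R :=
  n%:R^-1 * \sum_(i < n) kappa q i.

(* (div h)(v), with (nabla_X h)(Y, Z) spelled out for X = Y = E_i, Z = v. *)
Definition div_h (R : realType) (m n : nat) (M : set 'rV[R]_m)
    (D : ('rV[R]_m -> 'rV[R]_m) -> ('rV[R]_m -> 'rV[R]_m) ->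
         'rV[R]_m -> 'rV[R]_m)
    (E : 'I_n -> 'rV[R]_m -> 'rV[R]_m) (nu v : 'rV[R]_m -> 'rV[R]_m)
    (q : 'rV[R]_m) : R :=
  \sum_(i < n)
    (dalong (W := R^o) M (scalar_ff M nu (E i) v) q (E i q)
     - scalar_ff M nu (D (E i) (E i)) v q
     - scalar_ff M nu (E i) (D (E i) v) q).

(* Gamma^j_{ik} and nabla_i v^j in the frame E. *)
Definition christoffel (R : realType) (m n : nat)
    (D : ('rV[R]_m -> 'rV[R]_m) -> ('rV[R]_m -> 'rV[R]_m) ->
         'rV[R]_m -> 'rV[R]_m)
    (E : 'I_n -> 'rV[R]_m -> 'rV[R]_m) (j i k : 'I_n) (q : 'rV[R]_m) : R :=
  inner (D (E i) (E k) q) (E j q).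

Definition cov_comp (R : realType) (m n : nat) (M : set 'rV[R]_m)
    (D : ('rV[R]_m -> 'rV[R]_m) -> ('rV[R]_m -> 'rV[R]_m) ->
         'rV[R]_m -> 'rV[R]_m)
    (E : 'I_n -> 'rV[R]_m -> 'rV[R]_m) (v : 'rV[R]_m -> 'rV[R]_m)
    (i j : 'I_n) (q : 'rV[R]_m) : R :=
  dalong (W := R^o) M (fun x => inner (v x) (E j x)) q (E i q)
  + \sum_(k < n) christoffel D E j i k q * inner (v q) (E k q).

(* Main.v *)
Require Import Defs.
From HB Require Import structures.
From mathcomp Require Import all_boot all_order all_algebra.
From mathcomp Require Import all_classical all_reals all_analysis.
From mathcomp Require Import ring.
Set Implicit Arguments.
Unset Strict Implicit.
Unset Printing Implicit Defensive.
Import Order.TTheory GRing.Theory Num.Theory.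
Import numFieldNormedType.Exports.
Local Open Scope classical_set_scope.
Local Open Scope ring_scope.

(** The whole geometry of [M] is carried by one smooth matrix-valued function:
    near [p], let [P x] be the orthogonal projector onto the span of the [E_i x],
    [P x = \sum_i (E_i x)^T *m E_i x].  Vectors are rows, so that [u *m P x] is the
    projection of [u].  On [M] the tangent vectors at [q] are the fixed vectors of
    [P q] ([tangentP]: one inclusion is the definition of normal fields, the other
    needs the tangent vectors to form a vector space, [tangent_linear], which is
    read off a slice chart).

    Write [dP a] for the derivative of [P] in the direction [a].  Differentiating
    [P^2 = P = P^T] shows that [dP a] is symmetric and exchanges tangent and normal
    vectors; differentiating [Y P = Y] for a tangent field, or [eta P = 0] for a
    normal one, then gives
      [II(X, Y) = Y *m dP X]   and   [W_eta X = eta *m dP X]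
    ([second_ffE], [weingartenE]).  The Levi-Civita connection is the tangential
    part of the flat one ([nablaE]): this is the uniqueness argument behind Koszul's
    formula.  The brackets of tangent fields are tangent because they are
    differences of covariant derivatives, whence the symmetry
    [y *m dP x = x *m dP y] of the second fundamental form ([shape_symmetric]).

    Three second-order identities follow by differentiating once more, and they use
    the symmetry of second derivatives ([derive2C], proved from the mean value
    theorem): the Gauss equation ([curvature], [gauss]), which gives
    [Ric v = n W_H v - \sum_l W_(N_l) W_(N_l) v] ([ricci_formula]); the Codazzi
    equation ([codazzi], [codazzi_dII]), which identifies the normal part of
    [n D_v H] with the trace of the covariant derivative of the second fundamental
    form, its tangent part being [- n W_H v] ([derive_mean_curvature]); and the
    decomposition of the tangential Hessian of [v] obtained by differentiating
    [v P = v] twice ([hess_tangent_field], [hess_split]).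

    Both Bochner Laplacians are minus the trace of a bilinear form at [p]: the
    Hessian of [v] for the flat connection, the second covariant derivative [cov2]
    for [nabla].  Such a trace depends on the frame only through its projector
    ([trace_frame]), so the frames [F] and [G] may be exchanged for the adapted one,
    and the ambient trace splits into a tangential and a normal sum.  The normal sum
    produces the terms in [N_l]; [hess_split] turns the tangential one into the
    remaining terms.  This is the third formula ([bochner_formula]); the other three
    differ from it by the formula for [Ric] and the expression of [n [H, v]]
    ([bracket_mean_curvature]).

    For a hypersurface every normal vector is a multiple of [N], and it remains to
    compute components along [N]: [D_N N] is tangent since [N] is a unit field,
    [E_i] is an eigenvector of the shape operator at [p], and the mean curvature,
    being a trace, is the normal component of a smooth field although the principal
    curvatures themselves need not be smooth ([mean_curvature_inner]). *)

(** * Differentiability of matrix-valued functions *)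

Section Differentiability.
Context {R : realType} {V : normedModType R}.

(** Differentiability only depends on the germ: [g - f] vanishes near [x], so it
    has the zero map as differential. *)
Lemma differentiable_near (W : normedModType R) (f g : V -> W) (x : V) :
  {near x, f =1 g} -> differentiable f x -> differentiable g x.
Proof.
move=> fg df.
have -> : g = f + (g - f) by rewrite funeqE => y /=; rewrite addrC subrK.
apply: differentiableD => //.
set h := g - f.
have hx : h x = 0 by rewrite -[h x]/(g x - f x) (nbhs_singleton fg) subrr.
have h0 : {near x, h =1 cst 0}.
  by near=> y; rewrite -[h y]/(g y - f y) (near fg y) // subrr.
have E : continuous (0 : V -> W) /\
    h \o shift x = cst (h x) + (0 : V -> W) +o_ (0 : V) id.
  split; first exact: cst_continuous.
  rewrite hx addr0; apply/eqaddoP => e e0.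
  have : \forall y \near (0 : V), h (y + x) = 0.
    have c : (y + x) @[y --> (0 : V)] --> x.
      by rewrite -{2}(add0r x); apply: cvgD; [exact: cvg_id | exact: cvg_cst].
    exact: (c _ h0).
  apply: filterS => y yx.
    have -> : (h \o shift x - cst 0) y = 0.
      by rewrite -[LHS]/(h (y + x) - 0) yx subrr.
    by rewrite normr0 mulr_ge0 // ltW.
have D : 'd h x = 0 :> (V -> W) by apply/diff_unique; case: E.
by apply/diff_locallyP; rewrite D.
Unshelve. all: by end_near. Qed.

Lemma differentiable_mx (m n : nat) (f : V -> 'M[R]_(m, n)) (x : V) :
  (forall i j, differentiable (fun y => f y i j : R^o) x) -> differentiable f x.
Proof.
move=> df.
have -> : f = \sum_(i < m) \sum_(j < n) (fun y => f y i j *: delta_mx i j).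
  rewrite funeqE => y; rewrite fct_sumE {1}[f y]matrix_sum_delta.
  by apply: eq_bigr => i _; rewrite fct_sumE.
apply: differentiable_sum => i; apply: differentiable_sum => j.
exact: differentiableZl.
Qed.

Lemma differentiable_entry (m n : nat) (f : V -> 'M[R]_(m, n)) (x : V) i j :
  differentiable f x -> differentiable (fun y => f y i j : R^o) x.
Proof.
move=> df; apply: (@differentiable_comp _ _ _ _ f (fun A => A i j)) => //.
exact: differentiable_coord.
Qed.

Lemma derive_entry (m n : nat) (f : V -> 'M[R]_(m, n)) (x w : V) i j :
  differentiable f x -> ('D_w f x) i j = 'D_w (fun y => f y i j : R^o) x.
Proof. by move=> df; rewrite derive_mx ?mxE //; exact: diff_derivable. Qed.

Lemma differentiable_mulmx (m n p : nat) (f : V -> 'M[R]_(m, n))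
    (g : V -> 'M[R]_(n, p)) (x : V) :
  differentiable f x -> differentiable g x ->
  differentiable (fun y => f y *m g y) x.
Proof.
move=> df dg; apply: differentiable_mx => i j.
have -> : (fun y => (f y *m g y) i j : R^o) =
    \sum_(k < n) ((fun y => f y i k : R^o) * (fun y => g y k j : R^o)).
  by rewrite funeqE => y; rewrite fct_sumE mxE.
by apply: differentiable_sum => k; apply: differentiableM;
  apply: differentiable_entry.
Qed.

Lemma derive_mulmx (m n p : nat) (f : V -> 'M[R]_(m, n))
    (g : V -> 'M[R]_(n, p)) (x w : V) :
  differentiable f x -> differentiable g x ->
  'D_w (fun y => f y *m g y) x = 'D_w f x *m g x + f x *m 'D_w g x.
Proof.
move=> df dg; apply/matrixP => i j.
rewrite derive_entry; last exact: differentiable_mulmx.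
have -> : (fun y => (f y *m g y) i j : R^o) =
    \sum_(k < n) ((fun y => f y i k : R^o) * (fun y => g y k j : R^o)).
  by rewrite funeqE => y; rewrite fct_sumE mxE.
have df' k : derivable (fun y => f y i k : R^o) x w.
  by apply/diff_derivable/differentiable_entry.
have dg' k : derivable (fun y => g y k j : R^o) x w.
  by apply/diff_derivable/differentiable_entry.
rewrite derive_sum; last by move=> k; apply: derivableM.
rewrite !mxE -big_split /=; apply: eq_bigr => k _.
rewrite deriveM // !derive_entry // addrC; congr (_ + _).
by rewrite mulrC.
Qed.

(** Linear maps out of a matrix space are finite sums of coordinates, so that no
    continuity has to be assumed. *)
Lemma differentiable_linmx (m n : nat) (W : normedModType R)
    (L : {linear 'M[R]_(m, n) -> W}) (f : V -> 'M[R]_(m, n)) (x : V) :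
  differentiable f x -> differentiable (L \o f) x.
Proof.
move=> df.
have -> : L \o f = \sum_(i < m) \sum_(j < n) (fun y => f y i j *: L (delta_mx i j)).
  rewrite funeqE => y; rewrite fct_sumE /= {1}[f y]matrix_sum_delta linear_sum.
  apply: eq_bigr => i _; rewrite fct_sumE linear_sum.
  by apply: eq_bigr => j _; rewrite linearZ.
apply: differentiable_sum => i; apply: differentiable_sum => j.
by apply: differentiableZl; apply: differentiable_entry.
Qed.

Lemma derive_linmx (m n : nat) (W : normedModType R)
    (L : {linear 'M[R]_(m, n) -> W}) (f : V -> 'M[R]_(m, n)) (x w : V) :
  differentiable f x -> 'D_w (L \o f) x = L ('D_w f x).
Proof.
move=> df.
have -> : L \o f = \sum_(i < m) \sum_(j < n) (fun y => f y i j *: L (delta_mx i j)).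
  rewrite funeqE => y; rewrite fct_sumE /= {1}[f y]matrix_sum_delta linear_sum.
  apply: eq_bigr => i _; rewrite fct_sumE linear_sum.
  by apply: eq_bigr => j _; rewrite linearZ.
have dZ i j : differentiable (fun y => f y i j *: L (delta_mx i j)) x.
  by apply: differentiableZl; apply: differentiable_entry.
rewrite derive_sum; last first.
  by move=> i; apply/diff_derivable/differentiable_sum.
rewrite [X in L X]matrix_sum_delta linear_sum; apply: eq_bigr => i _.
rewrite derive_sum; last by move=> j; apply/diff_derivable.
rewrite linear_sum; apply: eq_bigr => j _.
have de : differentiable (fun y => f y i j : R^o) x.
  exact: differentiable_entry.
by rewrite linearZ /= deriveE // diffZl //= derive_entry // deriveE.
Qed.

Lemma derive_lin (W : normedModType R) (f : V -> W) (x : V) :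
  differentiable f x -> linear (fun w => 'D_w f x).
Proof. by move=> df a u w; rewrite !deriveE // linearP. Qed.

End Differentiability.

(** * Smooth functions *)
Section Smoothness.
Context {R : realType} {V : normedModType R}.
Implicit Types (U O : set V).

Lemma near_open U (W : Type) (f g : V -> W) (x : V) :
  open U -> U x -> (forall y, U y -> f y = g y) -> {near x, f =1 g}.
Proof.
move=> Uo Ux fg.
have : \forall y \near x, U y by apply: open_nbhs_nbhs; split.
by apply: filterS => y /fg.
Qed.

Lemma derive_open U (W : normedModType R) (f g : V -> W) (x w : V) :
  open U -> U x -> (forall y, U y -> f y = g y) -> 'D_w f x = 'D_w g x.
Proof. by move=> Uo Ux fg; apply: near_eq_derive; exact: (near_open Uo Ux fg). Qed.

Lemma Ck_on_eq (W : normedModType R) r U (f g : V -> W) :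
  open U -> (forall y, U y -> f y = g y) -> Ck_on r U f -> Ck_on r U g.
Proof.
move=> Uo; elim: r f g => [|r IHr] f g fg /=.
  move=> fc x Ux; have := fc x Ux.
  rewrite /prop_for /continuous_at (fg x Ux) => fx.
  apply: cvg_trans fx; apply: near_eq_cvg.
  exact: (near_open Uo Ux fg).
case=> df Df; split=> [x Ux|w].
  exact: (differentiable_near (near_open Uo Ux fg) (df x Ux)).
by apply: IHr (Df w) => y Uy; apply: derive_open Uo Uy fg.
Qed.

Lemma smooth_on_eq (W : normedModType R) U (f g : V -> W) :
  open U -> (forall y, U y -> f y = g y) -> smooth_on U f -> smooth_on U g.
Proof. by move=> Uo fg sf r; apply: Ck_on_eq Uo fg (sf r). Qed.

Lemma smooth_differentiable (W : normedModType R) U (f : V -> W) x :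
  smooth_on U f -> U x -> differentiable f x.
Proof. by move=> /(_ 1%N)[df _] /df. Qed.

Lemma smooth_derive (W : normedModType R) U (f : V -> W) w :
  smooth_on U f -> smooth_on U ('D_w f).
Proof. by move=> sf r; case: (sf r.+1) => _; exact. Qed.

Lemma smooth_subset (W : normedModType R) U O (f : V -> W) :
  O `<=` U -> smooth_on U f -> smooth_on O f.
Proof.
move=> OU sf r; elim: r f sf => [|r IHr] f sf.
  by move=> x /OU Ux; apply: (sf 0%N).
split=> [x /OU Ux|w]; first exact: smooth_differentiable Ux.
by apply/IHr/smooth_derive.
Qed.

Lemma smooth_cst (W : normedModType R) U (c : W) : smooth_on U (cst c).
Proof.
move=> r; elim: r c => [|r IHr] c.
  by move=> x _; exact: cst_continuous.
split=> [x _|w]; first exact: differentiable_cst.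
have -> : (fun x => 'D_w (cst c) x) = cst 0.
  by apply: funext => x; exact: derive_cst.
exact: IHr.
Qed.

Lemma Ck_onD (W : normedModType R) r U (f g : V -> W) : open U ->
  Ck_on r U f -> Ck_on r U g -> Ck_on r U (fun x => f x + g x).
Proof.
move=> Uo; elim: r f g => [|r IHr] f g.
  by move=> cf cg x Ux; apply: continuousD; [exact: cf | exact: cg].
move=> [df Df] [dg Dg]; split=> [x Ux|w].
  by apply: differentiableD; [exact: df | exact: dg].
apply: (@Ck_on_eq _ r U (fun x => 'D_w f x + 'D_w g x)) => //.
  by move=> x Ux; rewrite -deriveD //; apply: diff_derivable; [exact: df | exact: dg].
by apply: IHr; [exact: Df | exact: Dg].
Qed.

Lemma smoothD (W : normedModType R) U (f g : V -> W) : open U ->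
  smooth_on U f -> smooth_on U g -> smooth_on U (fun x => f x + g x).
Proof. by move=> Uo sf sg r; apply: Ck_onD. Qed.

Lemma smooth_sum (W : normedModType R) (I : Type) (s : seq I) U
    (f : I -> V -> W) : open U ->
  (forall i, smooth_on U (f i)) -> smooth_on U (fun x => \sum_(i <- s) f i x).
Proof.
move=> Uo sf; elim: s => [|i s IHs].
  by apply: smooth_on_eq Uo _ (smooth_cst U (0 : W)) => x _; rewrite big_nil.
by apply: smooth_on_eq Uo _ (smoothD Uo (sf i) IHs) => x _; rewrite big_cons.
Qed.

(** The induction is on the order of differentiation for all smooth [f] and [g] at
    once: Leibniz' rule puts [f] and [g] themselves next to their derivatives, so
    that a hypothesis of a fixed order would have to be weakened at each step. *)
Lemma smooth_mulmx (m n p : nat) U (f : V -> 'M[R]_(m, n))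
    (g : V -> 'M[R]_(n, p)) : open U ->
  smooth_on U f -> smooth_on U g -> smooth_on U (fun x => f x *m g x).
Proof.
move=> Uo sf sg r; elim: r f g sf sg => [|r IHr] f g sf sg.
  move=> x Ux; apply: differentiable_continuous.
  by apply: differentiable_mulmx; apply: smooth_differentiable Ux.
split=> [x Ux|w].
  by apply: differentiable_mulmx; apply: smooth_differentiable Ux.
apply: (@Ck_on_eq _ r U (fun x => 'D_w f x *m g x + f x *m 'D_w g x)) => //.
  by move=> x Ux; rewrite derive_mulmx //; apply: smooth_differentiable Ux.
by apply: Ck_onD => //; apply: IHr => //; apply: smooth_derive.
Qed.

Lemma smooth_linmx (m n : nat) (W : normedModType R) U
    (L : {linear 'M[R]_(m, n) -> W}) (f : V -> 'M[R]_(m, n)) : open U ->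
  smooth_on U f -> smooth_on U (fun x => L (f x)).
Proof.
move=> Uo sf r; elim: r f sf => [|r IHr] f sf.
  move=> x Ux; apply: differentiable_continuous.
  by apply: (differentiable_linmx L); apply: smooth_differentiable Ux.
split=> [x Ux|w].
  by apply: (differentiable_linmx L); apply: smooth_differentiable Ux.
apply: (@Ck_on_eq _ r U (fun x => L ('D_w f x))) => //.
  by move=> x Ux; rewrite -(derive_linmx L) //; apply: smooth_differentiable Ux.
by apply: IHr; apply: smooth_derive.
Qed.

End Smoothness.

Section Hessian.
Context {R : realType} {V : normedModType R}.

Lemma derive_line (W : normedModType R) (f : V -> W) (x a : V) (t : R) :
  differentiable f (x + t *: a) ->
  is_derive (t : R^o) (1 : R^o) (fun s : R^o => f (x + s *: a)) ('D_a f (x + t *: a)).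
Proof.
move=> df.
have dl : differentiable (fun s : R^o => x + s *: a) t.
  by apply: differentiableD => //; exact: differentiableZl.
have dc : differentiable (fun s : R^o => f (x + s *: a)) t.
  exact: (@differentiable_comp _ _ _ _ (fun s : R^o => x + s *: a) f).
apply: DeriveDef; first exact: diff_derivable.
rewrite deriveE // (@diff_comp _ _ _ _ (fun s : R^o => x + s *: a) f) //=.
rewrite deriveE //; congr ('d _ _ _).
rewrite diffD //=.
by rewrite diff_cst diffZl //= add0r diff_val scale1r.
Qed.

Lemma MVT_line (f : V -> R^o) (x a : V) (h : R) : 0 < h ->
  (forall s, 0 <= s <= h -> differentiable f (x + s *: a)) ->
  exists2 s, 0 < s < h & f (x + h *: a) - f x = h * 'D_a f (x + s *: a).
Proof.
move=> h0 df.
have [||s s0h e] := @MVT R (fun s => f (x + s *: a))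
    (fun s => 'D_a f (x + s *: a)) 0 h h0.
- move=> s; rewrite in_itv /= => /andP[s0 sh]; apply: derive_line.
  by apply: df; rewrite !ltW.
- apply: derivable_within_continuous => s; rewrite in_itv /= => sh.
  by have [] := derive_line (df s sh).
exists s; first by move: s0h; rewrite in_itv.
by move: e; rewrite scale0r addr0 subr0 mulrC.
Qed.

End Hessian.

(** * Symmetry of second derivatives *)

(* Unification would otherwise unfold derivatives into limits of filters. *)
Opaque derive.

Section Schwarz.
Context {R : realType} {V : normedModType R}.

Lemma small_parallelogram (A : set V) (x a b : V) : nbhs x A ->
  exists2 h : R, 0 < h & forall s t : R, 0 <= s <= h -> 0 <= t <= h ->
    A (x + s *: a + t *: b).
Proof.
move=> /nbhs_normP[e /= e0 xeA].
have d0 : 0 < `|a| + `|b| + 1 by rewrite ltr_wpDl // addr_ge0.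
exists (e / (`|a| + `|b| + 1)); first exact: divr_gt0.
move=> s t /andP[s0 sh] /andP[t0 th]; apply: xeA => /=.
rewrite -addrA opprD addNKr normrN.
apply: (le_lt_trans (ler_normD _ _)).
rewrite !normrZ (ger0_norm s0) (ger0_norm t0).
apply: (@le_lt_trans _ _ (e / (`|a| + `|b| + 1) * (`|a| + `|b|))).
  by rewrite mulrDr lerD // ler_wpM2r.
by rewrite -mulrA gtr_pMr // mulrC ltr_pdivrMr // mul1r ltrDl.
Qed.

(** The second difference of [F] over a small parallelogram is, by the mean
    value theorem along each side in turn, a value of an iterated directional
    derivative; it does not depend on the order in which the two sides are
    taken. *)
Lemma second_difference (U A : set V) (F : V -> R^o) (x y a b : V) (h : R) :
  smooth_on U F -> 0 < h -> A `<=` U -> y = x + h *: a + h *: b ->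
  (forall s t, 0 <= s <= h -> 0 <= t <= h -> A (x + s *: a + t *: b)) ->
  exists2 z, A z & F y - F (x + h *: a) - (F (x + h *: b) - F x) =
    h * (h * 'D_b ('D_a F) z).
Proof.
move=> sF h0 AU yE UF.
have hh : 0 <= h <= h by rewrite lexx ltW.
have oh : (0 : R) <= 0 <= h by rewrite lexx ltW.
have dF s t : 0 <= s <= h -> 0 <= t <= h ->
    differentiable F (x + s *: a + t *: b).
  by move=> sh th; apply: smooth_differentiable sF (AU _ (UF _ _ sh th)).
have dF0 s : 0 <= s <= h -> differentiable F (x + s *: a).
  by move=> sh; have := dF s 0 sh oh; rewrite scale0r addr0.
have dFs s : 0 <= s <= h -> differentiable (fun y => F (y + h *: b)) (x + s *: a).
  move=> sh; apply: (@differentiable_comp _ _ _ _ (fun y => y + h *: b) F).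
    by apply: differentiableD.
  exact: dF.
have [|s /andP[s0 sh] e1] := @MVT_line _ _ (fun y => F (y + h *: b) - F y) x a h h0.
  by move=> s sh; apply: differentiableB; [exact: dFs | exact: dF0].
have {}sh : 0 <= s <= h by rewrite !ltW.
have [|t /andP[t0 th] e2] := @MVT_line _ _ ('D_a F) (x + s *: a) b h h0.
  move=> t th; apply: (smooth_differentiable (smooth_derive a sF)).
  exact/AU/UF.
have {}th : 0 <= t <= h by rewrite !ltW.
exists (x + s *: a + t *: b); first exact: UF.
rewrite -e2 yE e1; congr (_ * _).
rewrite deriveB; [|exact/diff_derivable/dFs|exact/diff_derivable/dF0].
congr (_ - _).
rewrite deriveE; last exact: dFs.
rewrite (@diff_comp _ _ _ _ (fun y => y + h *: b) F) /=.
- rewrite deriveE; last exact: dF.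
  congr ('d _ _ _); rewrite diffD // diff_cst /= addr0.
  by rewrite diff_val.
- exact: differentiableD.
- exact: dF.
Qed.

Lemma dist_common_point (p q r e : R) :
  `|p - r| < e / 2 -> `|q - r| < e / 2 -> `|p - q| <= e.
Proof.
move=> pr qr; rewrite -(subrK r p) -addrA (le_trans (ler_normD _ _)) //.
by rewrite [leRHS]splitr lerD // ltW // distrC.
Qed.

(** Were the two derivatives different at [x], continuity would keep their
    values apart on a small parallelogram; but there [second_difference] provides
    two points at which the values agree. *)
Lemma derive2C_scalar (U : set V) (F : V -> R^o) (x a b : V) :
  open U -> U x -> smooth_on U F -> 'D_a ('D_b F) x = 'D_b ('D_a F) x.
Proof.
move=> Uo Ux sF.
apply/eqP; rewrite -subr_eq0 -normr_le0; apply/ler_addgt0Pl => e e0.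
rewrite addr0.
have e2 : 0 < e / 2 by rewrite divr_gt0.
have near2 c d : \forall y \near x, `|'D_c ('D_d F) x - 'D_c ('D_d F) y| < e / 2.
  have : Ck_on 0 U ('D_c ('D_d F)) by exact: smooth_derive c (smooth_derive d sF) 0%N.
  by move=> /(_ x Ux)/cvgrPdist_lt; exact.
have nU : \forall y \near x, U y by apply: open_nbhs_nbhs; split.
have [h h0 Uh] :=
  small_parallelogram a b (filterI nU (filterI (near2 a b) (near2 b a))).
have [|z [_ [_ Pz]] ez] := @second_difference U _ F x (x + h *: a + h *: b)
    a b h sF h0 _ erefl Uh; first by move=> z [].
have [|s t sh th|w [_ Pw] ew] := @second_difference U
    (U `&` [set y | `|'D_a ('D_b F) x - 'D_a ('D_b F) y| < e / 2]) F x
    (x + h *: a + h *: b) b a h sF h0 _ (addrAC _ _ _) _.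
- by move=> w [].
- have [Uy [Py _]] := Uh t s th sh.
  by have -> : x + s *: b + t *: a = x + t *: a + s *: b by rewrite addrAC.
have E : 'D_b ('D_a F) z = 'D_a ('D_b F) w.
  have h1 : h != 0 by rewrite gt_eqF.
  apply: (mulfI h1); apply: (mulfI h1); apply: etrans (esym ez) _.
  apply: etrans _ ew.
  move: (F _) (F _) (F _) (F _) => f1 f2 f3 f4.
  by rewrite !opprB addrACA [RHS]addrACA; congr (_ + _); rewrite addrC.
by apply: dist_common_point Pw _; rewrite -E.
Qed.

(** Schwarz's theorem, by comparison of entries. *)
Lemma derive2C (m n : nat) (U : set V) (f : V -> 'M[R]_(m, n)) (x a b : V) :
  open U -> U x -> smooth_on U f -> 'D_a ('D_b f) x = 'D_b ('D_a f) x.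
Proof.
move=> Uo Ux sf; apply/matrixP => i j.
have df c y : U y -> differentiable ('D_c f) y.
  exact: smooth_differentiable (smooth_derive c sf).
rewrite [LHS](derive_entry a i j (df b x Ux)) [RHS](derive_entry b i j (df a x Ux)).
have e c d : 'D_d (fun y => ('D_c f y) i j : R^o) x =
             'D_d ('D_c (fun y => f y i j : R^o)) x.
  apply: (derive_open _ Uo Ux) => y Uy; rewrite derive_entry //.
  exact: smooth_differentiable Uy.
rewrite !e; apply: (derive2C_scalar a b Uo Ux).
pose L := fun A : 'M[R]_(m, n) => A i j : R^o.
have Ll : linear L by move=> k u v; rewrite /L !mxE.
pose LL : {linear 'M[R]_(m, n) -> R^o} := HB.pack L (GRing.isLinear.Build _ _ _ _ _ Ll).
exact: (smooth_linmx LL).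
Qed.

End Schwarz.

Section FiniteDimension.
Context {R : realType} {m : nat}.
Implicit Types (U : set 'rV[R]_m).

(** The derivative in a variable direction, as a sum of products, so that it
    can be differentiated once more. *)
Lemma derive_rowE (a b : nat) (f : 'rV[R]_m -> 'M[R]_(a, b)) (x w : 'rV[R]_m) :
  differentiable f x ->
  'D_w f x = \sum_j (w 0 j)%:M *m 'D_(delta_mx 0 j) f x.
Proof.
move=> df; rewrite {1}[w]row_sum_delta deriveE // linear_sum.
by apply: eq_bigr => j _; rewrite linearZ /= mul_scalar_mx deriveE.
Qed.

Lemma smooth_derive_along (a b : nat) U (X : 'rV[R]_m -> 'rV[R]_m)
    (f : 'rV[R]_m -> 'M[R]_(a, b)) : open U ->
  smooth_on U X -> smooth_on U f -> smooth_on U (fun x => 'D_(X x) f x).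
Proof.
move=> Uo sX sf.
apply: (@smooth_on_eq _ _ _ U
    (fun x => \sum_j (X x 0 j)%:M *m 'D_(delta_mx 0 j) f x)) => //.
  by move=> x Ux; rewrite -derive_rowE //; exact: smooth_differentiable Ux.
apply: smooth_sum => // j; apply: smooth_mulmx => //; last exact: smooth_derive.
pose L := fun u : 'rV[R]_m => (u 0 j)%:M : 'M[R]_a.
have Ll : linear L.
  by move=> k u v; rewrite /L !mxE raddfD /= -scale_scalar_mx.
pose LL : {linear 'rV[R]_m -> 'M[R]_a} :=
  HB.pack L (GRing.isLinear.Build _ _ _ _ _ Ll).
exact: (smooth_linmx LL Uo sX).
Qed.

(** The derivative of [D_X f]: the second term accounts for the variation of the
    direction [X]. *)
Lemma derive_along (a b : nat) U (X : 'rV[R]_m -> 'rV[R]_m)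
    (f : 'rV[R]_m -> 'M[R]_(a, b)) (x w : 'rV[R]_m) : open U -> U x ->
  smooth_on U X -> smooth_on U f ->
  'D_w (fun y => 'D_(X y) f y) x = 'D_w ('D_(X x) f) x + 'D_('D_w X x) f x.
Proof.
move=> Uo Ux sX sf.
have df y : U y -> differentiable f y by apply: smooth_differentiable.
have dDf c y : U y -> differentiable ('D_c f) y.
  exact: smooth_differentiable (smooth_derive c sf).
have dX : differentiable X x by exact: smooth_differentiable Ux.
rewrite (derive_open w Uo Ux (fun y Uy => derive_rowE _ (df y Uy))).
pose L j := fun u : 'rV[R]_m => (u 0 j)%:M : 'M[R]_a.
have Ll j : linear (L j).
  by move=> k u v; rewrite /L !mxE raddfD /= -scale_scalar_mx.
pose LL j : {linear 'rV[R]_m -> 'M[R]_a} :=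
  HB.pack (L j) (GRing.isLinear.Build _ _ _ _ _ (Ll j)).
have dL j : differentiable (fun y => (X y 0 j)%:M : 'M[R]_a) x.
  exact: (differentiable_linmx (LL j) dX).
have DL j : 'D_w (fun y => (X y 0 j)%:M : 'M[R]_a) x = ('D_w X x 0 j)%:M.
  exact: (derive_linmx (LL j)).
have -> : (fun y => \sum_j (X y 0 j)%:M *m 'D_(delta_mx 0 j) f y) =
    \sum_j (fun y => (X y 0 j)%:M *m 'D_(delta_mx 0 j) f y).
  by rewrite funeqE => y; rewrite fct_sumE.
rewrite derive_sum; last first.
  by move=> j; apply/diff_derivable/differentiable_mulmx => //; exact: dDf.
have E j : 'D_w (fun y => (X y 0 j)%:M *m 'D_(delta_mx 0 j) f y) x =
    ('D_w X x 0 j)%:M *m 'D_(delta_mx 0 j) f x +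
    (X x 0 j)%:M *m 'D_w ('D_(delta_mx 0 j) f) x.
  by rewrite derive_mulmx ?DL //; exact: dDf.
under eq_bigr do rewrite E.
rewrite big_split /= addrC (derive_rowE ('D_w X x)); last exact: df.
congr (_ + _).
have -> : 'D_w ('D_(X x) f) x =
    'D_w (\sum_j (fun y => (X x 0 j)%:M *m 'D_(delta_mx 0 j) f y)) x.
  apply: (derive_open _ Uo Ux) => y Uy; rewrite fct_sumE derive_rowE //.
  exact: df.
rewrite derive_sum; last first.
  by move=> j; apply/diff_derivable/differentiable_mulmx => //; exact: dDf.
apply: eq_bigr => j _; rewrite derive_mulmx //; last exact: dDf.
by rewrite derive_cst mul0mx add0r.
Qed.

End FiniteDimension.

(** * Curves and tangent vectors *)

Section Curves.
Context {R : realType}.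

Lemma smooth_line (V W : normedModType R) (U : set V) (f : V -> W) (x a : V) :
  open U -> smooth_on U f ->
  open ([set t : R^o | U (x + t *: a)] : set R^o) /\
  smooth_on (V := R^o) [set t | U (x + t *: a)] (fun t => f (x + t *: a)).
Proof.
move=> Uo sf; set J := [set t : R^o | U (x + t *: a)].
have dl (t : R^o) : differentiable (fun s : R^o => x + s *: a) t.
  by apply: differentiableD => //; exact: differentiableZl.
have Jo : open (J : set R^o).
  apply: (@open_comp _ _ (fun s : R^o => x + s *: a) U) => // t _.
  exact: differentiable_continuous.
split=> // r; elim: r f sf => [|r IHr] f sf.
  move=> t Jt; apply: differentiable_continuous.
  apply: (@differentiable_comp _ _ _ _ (fun s : R^o => x + s *: a) f) => //.
  exact: (smooth_differentiable sf Jt).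
split=> [t Jt|w].
  apply: (@differentiable_comp _ _ _ _ (fun s : R^o => x + s *: a) f) => //.
  exact: (smooth_differentiable sf Jt).
apply: (@Ck_on_eq _ _ _ r J (fun t => 'D_((w : R) *: a) f (x + t *: a))) => //.
  move=> t Jt; have df := smooth_differentiable sf Jt.
  have dfl' : differentiable (fun s : R^o => f (x + s *: a)) t.
    exact: (@differentiable_comp _ _ _ _ (fun s : R^o => x + s *: a) f).
  have e : 'd (fun s : R^o => f (x + s *: a)) t w =
      (w : R) *: 'd (fun s : R^o => f (x + s *: a)) t 1.
    by rewrite -linearZ /=; congr ('d _ _ _); rewrite [RHS]mulr1.
  rewrite [RHS]deriveE // e -deriveE //.
  have [_ ->] := derive_line df.
  by rewrite deriveE // linearZ /= deriveE.
exact: (IHr ('D_((w : R) *: a) f) (smooth_derive _ sf)).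
Qed.

Lemma xget_curve_through (m : nat) (M : set 'rV[R]_m) (q w : 'rV[R]_m) :
  tangent M q w ->
  curve_through M q w (xget (cst q) [set c | curve_through M q w c]).
Proof.
by case=> c Tc; apply: (@xgetPex _ _ [set c | curve_through M q w c]); exists c.
Qed.

Lemma dalong_eq (m : nat) (W : normedModType R) (M O : set 'rV[R]_m)
    (f g : 'rV[R]_m -> W) (q w : 'rV[R]_m) :
  tangent M q w -> open O -> O q -> (forall x, M x -> O x -> f x = g x) ->
  dalong M f q w = dalong M g q w.
Proof.
move=> /xget_curve_through; rewrite /dalong; set c := xget _ _.
move=> [c0 c1 [J [Jo J0 sc Mc]]] Oo Oq fg.
have dc : differentiable (c : R^o -> _) 0 := smooth_differentiable sc J0.
rewrite !derive1E; apply: near_eq_derive.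
have nJ : \forall t \near (0 : R^o), J t by apply: open_nbhs_nbhs; split.
have nO : \forall t \near (0 : R^o), O (c t).
  apply: (differentiable_continuous dc); rewrite c0.
  by apply: open_nbhs_nbhs; split.
by apply: filterS (filterI nJ nO) => t [Jt Ot]; apply: fg => //; exact: Mc.
Qed.

(** Along a curve, a function on [M] and any differentiable extension of it have
    the same derivative; hence [dalong] is computed by extensions, and the curve
    chosen in its definition is immaterial. *)
Lemma dalongE (m : nat) (W : normedModType R) (M O : set 'rV[R]_m)
    (f g : 'rV[R]_m -> W) (q w : 'rV[R]_m) :
  tangent M q w -> open O -> O q -> (forall x, M x -> O x -> f x = g x) ->
  differentiable g q -> dalong M f q w = 'D_w g q.
Proof.
move=> Tw Oo Oq fg dg; rewrite (dalong_eq Tw Oo Oq fg).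
move: (xget_curve_through Tw); rewrite /dalong; set c := xget _ _.
move=> [c0 c1 [J [Jo J0 sc Mc]]].
have dc : differentiable (c : R^o -> _) 0 := smooth_differentiable sc J0.
have dg' : differentiable g (c 0) by rewrite c0.
rewrite derive1E deriveE; last exact: differentiable_comp.
rewrite (@diff_comp _ _ _ _ (c : R^o -> _)) //= c0 -deriveE //.
by rewrite -c1 (derive1E' dc).
Qed.

End Curves.

(** In a slice chart [phi] the tangent vectors of [M] at [q] are the [w] for
    which the last coordinates of the differential of [phi] vanish, a linear
    condition: such a [w] is the velocity of the image of a straight line under the
    inverse chart. *)
Lemma tangent_linear (R : realType) (n k : nat) (M : set 'rV[R]_(n + k))
    (q u w : 'rV[R]_(n + k)) (a : R) : embedded_submanifold M -> M q ->
  tangent M q u -> tangent M q w -> tangent M q (a *: u + w).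
Proof.
move=> M_sub Mq; have [Q [V [phi [psi]]]] := M_sub q Mq.
move=> [[Qo Vo Qq] [sphi spsi] psiK phiK slice].
have dphi : differentiable phi q := smooth_differentiable sphi Qq.
have [Vq psiq] := psiK q Qq.
suff tangentP t : tangent M q t <-> rsubmx ('D_t phi q) = 0.
  move=> /tangentP Tu /tangentP Tw; apply/tangentP.
  by rewrite (derive_lin dphi) linearP /= Tu Tw scaler0 addr0.
split=> [Tt|rt].
  have ds : differentiable (@rsubmx _ _ _ _ \o phi) q.
    by apply: differentiable_comp => //; exact: differentiable_rsubmx.
  rewrite -(derive_linmx (@rsubmx R 1 n k) t dphi).
  rewrite -(dalongE Tt Qo Qq (fun x _ _ => erefl) ds).
  rewrite (@dalongE _ _ _ M Q _ (cst 0) q t) ?derive_cst //.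
  by move=> x Mx Qx; apply/slice.
have [Jo sJ] := @smooth_line R _ _ V psi (phi q) ('D_t phi q) Vo spsi.
have dpsi : differentiable psi (phi q) := smooth_differentiable spsi Vq.
exists (fun s => psi (phi q + s *: 'D_t phi q)); split.
- by rewrite scale0r addr0.
- have dpsi0 : differentiable psi (phi q + 0 *: 'D_t phi q).
    by rewrite scale0r addr0.
  rewrite derive1E; have [_ ->] := derive_line dpsi0.
  rewrite scale0r addr0 deriveE // deriveE //.
  rewrite -[LHS]/(('d psi (phi q) \o 'd phi q) t) -diff_comp //.
  rewrite -deriveE; last exact: differentiable_comp.
  rewrite (@derive_open _ _ Q _ _ id q t Qo Qq) ?derive_id //.
  by move=> x /psiK[].
- exists [set s | V (phi q + s *: 'D_t phi q)]; split => //.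
    by rewrite /= scale0r addr0.
  move=> s /= Vs; have [Qpsi phipsi] := phiK _ Vs.
  apply/slice => //; rewrite phipsi linearD linearZ /= rt scaler0 addr0.
  exact/slice.
Qed.

(** * Orthonormal frames and projectors *)

Section Projectors.
Context {R : realType}.
Implicit Types m d : nat.

Lemma inner_mx m (u w : 'rV[R]_m) : u *m w^T = (inner u w)%:M.
Proof.
apply/matrixP => i j; rewrite !ord1 !mxE /= mulr1n; apply: eq_bigr => a _.
by rewrite mxE.
Qed.

Lemma innerE m (u w : 'rV[R]_m) : inner u w = (u *m w^T) 0 0.
Proof. by rewrite inner_mx mxE. Qed.

Lemma innerC m (u w : 'rV[R]_m) : inner u w = inner w u.
Proof. by apply: eq_bigr => i _; rewrite mulrC. Qed.

Lemma innerDl m (u u' w : 'rV[R]_m) : inner (u + u') w = inner u w + inner u' w.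
Proof. by rewrite !innerE mulmxDl mxE. Qed.

Lemma innerNl m (u w : 'rV[R]_m) : inner (- u) w = - inner u w.
Proof. by rewrite !innerE mulNmx mxE. Qed.

Lemma innerBl m (u u' w : 'rV[R]_m) : inner (u - u') w = inner u w - inner u' w.
Proof. by rewrite innerDl innerNl. Qed.

Lemma innerZl m (a : R) (u w : 'rV[R]_m) : inner (a *: u) w = a * inner u w.
Proof. by rewrite !innerE -scalemxAl mxE. Qed.

Lemma inner0l m (w : 'rV[R]_m) : inner 0 w = 0.
Proof. by rewrite innerE mul0mx mxE. Qed.

Lemma inner_suml m (I : Type) (s : seq I) (u : I -> 'rV[R]_m) (w : 'rV[R]_m) :
  inner (\sum_(i <- s) u i) w = \sum_(i <- s) inner (u i) w.
Proof.
by rewrite innerE mulmx_suml summxE; apply: eq_bigr => i _; rewrite innerE.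
Qed.

Lemma inner_mulmxl m (u w : 'rV[R]_m) (A : 'M[R]_m) :
  inner (u *m A) w = inner u (w *m A^T).
Proof. by rewrite !innerE trmx_mul trmxK mulmxA. Qed.

Lemma inner_eq0 m (u : 'rV[R]_m) : inner u u = 0 -> u = 0.
Proof.
move=> /eqP; rewrite /inner psumr_eq0; last by move=> i _; rewrite -expr2 sqr_ge0.
move=> /allP u0; apply/rowP => i; have := u0 i (mem_index_enum i).
by rewrite mulf_eq0 orbb mxE => /eqP.
Qed.

(** The orthogonal projector onto the span of [e] when [e] is orthonormal; vectors
    are rows, so it acts by multiplication on the right. *)
Definition frame_proj d m (e : 'I_d -> 'rV[R]_m) : 'M[R]_m :=
  \sum_i (e i)^T *m e i.

Lemma mul_frame_proj d m (e : 'I_d -> 'rV[R]_m) (u : 'rV[R]_m) :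
  u *m frame_proj e = \sum_i inner u (e i) *: e i.
Proof.
rewrite /frame_proj mulmx_sumr; apply: eq_bigr => i _.
by rewrite mulmxA inner_mx mul_scalar_mx.
Qed.

Lemma frame_proj_sym d m (e : 'I_d -> 'rV[R]_m) :
  (frame_proj e)^T = frame_proj e.
Proof.
rewrite /frame_proj raddf_sum; apply: eq_bigr => i _ /=.
by rewrite trmx_mul trmxK.
Qed.

Lemma frame_proj_fix d m (e : 'I_d -> 'rV[R]_m) i :
  Defs.orthonormal e -> e i *m frame_proj e = e i.
Proof.
move=> on; rewrite mul_frame_proj (bigD1 i) //= on eqxx scale1r.
by rewrite big1 ?addr0 // => j /negPf ij; rewrite on eq_sym ij scale0r.
Qed.

Lemma frame_proj_idem d m (e : 'I_d -> 'rV[R]_m) :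
  Defs.orthonormal e -> frame_proj e *m frame_proj e = frame_proj e.
Proof.
move=> on; rewrite {1}/frame_proj mulmx_suml; apply: eq_bigr => i _.
by rewrite -mulmxA frame_proj_fix.
Qed.

Lemma frame_projE d m (e : 'I_d -> 'rV[R]_m) :
  frame_proj e = (\matrix_i e i)^T *m \matrix_i e i.
Proof.
apply/matrixP => a b; rewrite !mxE summxE; apply: eq_bigr => i _.
by rewrite !mxE big_ord1 !mxE.
Qed.

Lemma frame_gram d d' m (e : 'I_d -> 'rV[R]_m) (e' : 'I_d' -> 'rV[R]_m) :
  (\matrix_i e i) *m (\matrix_i e' i)^T = \matrix_(i, j) inner (e i) (e' j).
Proof.
by apply/matrixP => i j; rewrite !mxE; apply: eq_bigr => a _; rewrite !mxE.
Qed.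

Lemma frame_gram1 d m (e : 'I_d -> 'rV[R]_m) :
  Defs.orthonormal e -> (\matrix_i e i) *m (\matrix_i e i)^T = 1%:M.
Proof. by move=> on; rewrite frame_gram; apply/matrixP => i j; rewrite !mxE on. Qed.

(** A square matrix with orthonormal rows has orthonormal columns. *)
Lemma frame_proj_full m (e : 'I_m -> 'rV[R]_m) :
  Defs.orthonormal e -> frame_proj e = 1%:M.
Proof. by move=> on; rewrite frame_projE; apply: mulmx1C; exact: frame_gram1. Qed.

Lemma orthonormal_delta m : Defs.orthonormal (fun j : 'I_m => delta_mx 0 j : 'rV[R]_m).
Proof.
move=> a b; rewrite /inner (bigD1 a) //= !mxE !eqxx /= mul1r.
rewrite big1 ?addr0 ?mxE ?eqxx // => i /negPf ia.
by rewrite !mxE eqxx ia mul0r.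
Qed.

Lemma frame_proj_join n k (E : 'I_n -> 'rV[R]_(n + k) -> 'rV[R]_(n + k))
    (N : 'I_k -> 'rV[R]_(n + k) -> 'rV[R]_(n + k)) (q : 'rV[R]_(n + k)) :
  Defs.orthonormal (join_frame E N q) ->
  frame_proj (E^~ q) + frame_proj (N^~ q) = 1%:M.
Proof.
move=> on; rewrite !frame_projE -mul_row_col -tr_col_mx; apply: mulmx1C.
rewrite tr_col_mx mul_col_row !frame_gram scalar_mx_block.
by congr block_mx; apply/matrixP => i j; rewrite !mxE ?(on (inl _) (inl _))
  ?(on (inl _) (inr _)) ?(on (inr _) (inl _)) ?(on (inr _) (inr _)).
Qed.

(** Two orthonormal families of the same length have the same projector as soon
    as one lies in the span of the other: the matrix of change of frame has
    orthonormal rows, hence orthonormal columns. *)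
Lemma frame_proj_change d m (g e : 'I_d -> 'rV[R]_m) :
  Defs.orthonormal g -> Defs.orthonormal e -> (forall i, g i *m frame_proj e = g i) ->
  frame_proj g = frame_proj e.
Proof.
move=> ong one ge.
set g' := \matrix_i g i; set e' := \matrix_i e i.
have [A AA g'e] : exists2 A : 'M[R]_d, A *m A^T = 1%:M & g' = A *m e'.
  have g'e : g' = (g' *m e'^T) *m e'.
    rewrite -mulmxA -frame_projE; apply/row_matrixP => i.
    by rewrite row_mul rowK ge.
  exists (g' *m e'^T) => //.
  by rewrite trmx_mul trmxK mulmxA -g'e frame_gram1.
rewrite !frame_projE -/g' -/e' g'e trmx_mul mulmxA -(mulmxA e'^T).
by rewrite (mulmx1C AA) mulmx1.
Qed.

Lemma linear_rowE (W : lmodType R) m (f : 'rV[R]_m -> W) (u : 'rV[R]_m) :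
  linear f -> f u = \sum_j u 0 j *: f (delta_mx 0 j).
Proof.
move=> lf; pose F : {linear 'rV[R]_m -> W} :=
  HB.pack f (GRing.isLinear.Build _ _ _ _ _ lf).
rewrite -[f]/(F : _ -> _) {1}[u]row_sum_delta linear_sum.
by apply: eq_bigr => j _; rewrite linearZ.
Qed.

(** The trace of a bilinear map over a family of vectors depends on the family
    only through its projector. *)
Lemma trace_contract (W : lmodType R) d m (b : 'rV[R]_m -> 'rV[R]_m -> W)
    (e : 'I_d -> 'rV[R]_m) :
  (forall u, linear (b u)) -> (forall u, linear (b^~ u)) ->
  \sum_i b (e i) (e i) =
  \sum_j \sum_l frame_proj e j l *: b (delta_mx 0 j) (delta_mx 0 l).
Proof.
move=> br bl.
transitivity (\sum_i \sum_j \sum_l (e i 0 j * e i 0 l) *: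
                b (delta_mx 0 j) (delta_mx 0 l)).
  apply: eq_bigr => i _; rewrite (linear_rowE (e i) (bl (e i))).
  apply: eq_bigr => j _; rewrite (linear_rowE (e i) (br (delta_mx 0 j))).
  by rewrite scaler_sumr; apply: eq_bigr => l _; rewrite scalerA.
rewrite exchange_big; apply: eq_bigr => j _ /=.
rewrite exchange_big; apply: eq_bigr => l _ /=.
rewrite /frame_proj summxE scaler_suml; apply: eq_bigr => i _.
by rewrite mxE big_ord1 mxE.
Qed.

Lemma trace_frame (W : lmodType R) d d' m (b : 'rV[R]_m -> 'rV[R]_m -> W)
    (e : 'I_d -> 'rV[R]_m) (e' : 'I_d' -> 'rV[R]_m) :
  (forall u, linear (b u)) -> (forall u, linear (b^~ u)) ->
  frame_proj e = frame_proj e' -> \sum_i b (e i) (e i) = \sum_i b (e' i) (e' i).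
Proof. by move=> br bl ee; rewrite !trace_contract // ee. Qed.

Lemma trace_frame_join (W : lmodType R) d n k m (b : 'rV[R]_m -> 'rV[R]_m -> W)
    (f : 'I_d -> 'rV[R]_m) (e : 'I_n -> 'rV[R]_m) (e' : 'I_k -> 'rV[R]_m) :
  (forall u, linear (b u)) -> (forall u, linear (b^~ u)) ->
  frame_proj f = frame_proj e + frame_proj e' ->
  \sum_i b (f i) (f i) = \sum_i b (e i) (e i) + \sum_i b (e' i) (e' i).
Proof.
move=> br bl ee; rewrite !trace_contract // ee -big_split; apply: eq_bigr => j _.
by rewrite -big_split; apply: eq_bigr => l _; rewrite mxE scalerDl.
Qed.

End Projectors.

(** * Derivatives along the submanifold *)

(* As for [derive], these are only used through their lemmas from here on. *)
Opaque dalong inner.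

Section AlongSubmanifold.
Context {R : realType} {m : nat}.
Local Notation vec := 'rV[R]_m.
Variables (M U : set vec).
Hypothesis Uo : open U.

Lemma smooth_on_along (W : normedModType R) (f : vec -> W) :
  smooth_on U f -> smooth_along M U f.
Proof. by move=> sf q Mq Uq; exists U, f; split. Qed.

Lemma smooth_along_ext (W : normedModType R) (f : vec -> W) (q : vec) :
  smooth_along M U f -> M q -> U q ->
  exists (V : set vec) (g : vec -> W), [/\ open V, V q, V `<=` U, smooth_on V g &
    forall x, M x -> V x -> f x = g x].
Proof.
move=> sf Mq Uq; have [V [g [Vo Vq sg fg]]] := sf q Mq Uq.
exists (V `&` U), g; split => //; first exact: openI.
- by apply: smooth_subset sg => x [].
- by move=> x Mx [Vx _]; apply: fg.
Qed.

Lemma dalong_smooth (W : normedModType R) (f : vec -> W) (q w : vec) :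
  smooth_on U f -> U q -> tangent M q w -> dalong M f q w = 'D_w f q.
Proof.
move=> sf Uq Tw; apply: (dalongE Tw Uo Uq) => //.
exact: smooth_differentiable Uq.
Qed.

Lemma dalong_mulmx (a b c : nat) (f : vec -> 'M[R]_(a, b))
    (g : vec -> 'M[R]_(b, c)) (q w : vec) :
  smooth_along M U f -> smooth_along M U g -> M q -> U q -> tangent M q w ->
  dalong M (fun x => f x *m g x) q w =
    dalong M f q w *m g q + f q *m dalong M g q w.
Proof.
move=> sf sg Mq Uq Tw.
have [V1 [f1 [V1o V1q V1U sf1 ff1]]] := smooth_along_ext sf Mq Uq.
have [V2 [g2 [V2o V2q V2U sg2 gg2]]] := smooth_along_ext sg Mq Uq.
have df1 := smooth_differentiable sf1 V1q.
have dg2 := smooth_differentiable sg2 V2q.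
rewrite (dalongE Tw V1o V1q ff1 df1) (dalongE Tw V2o V2q gg2 dg2).
rewrite ff1 // gg2 // -derive_mulmx //.
apply: (dalongE Tw (openI V1o V2o)); first by split.
  by move=> x Mx [V1x V2x]; rewrite ff1 // gg2.
exact: differentiable_mulmx.
Qed.

Lemma derive_inner (V : normedModType R) (f g : V -> vec) (x w : V) :
  differentiable f x -> differentiable g x ->
  differentiable (fun y => inner (f y) (g y) : R^o) x /\
  'D_w (fun y => inner (f y) (g y) : R^o) x =
    inner ('D_w f x) (g x) + inner (f x) ('D_w g x).
Proof.
move=> df dg.
have dgT : differentiable (fun y => (g y)^T) x.
  exact: (differentiable_linmx (@trmx R 1 m)).
have -> : (fun y => inner (f y) (g y) : R^o) = (fun y => (f y *m (g y)^T) 0 0).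
  by rewrite funeqE => y; rewrite innerE.
have dfg := differentiable_mulmx df dgT.
split; first exact: differentiable_entry.
rewrite -derive_entry // derive_mulmx //.
have -> : 'D_w (fun y => (g y)^T) x = ('D_w g x)^T.
  exact: (derive_linmx (@trmx R 1 m)).
by rewrite mxE -!innerE.
Qed.

Lemma dalong_inner (f g : vec -> vec) (q w : vec) :
  smooth_along M U f -> smooth_along M U g -> M q -> U q -> tangent M q w ->
  dalong (W := R^o) M (fun x => inner (f x) (g x)) q w =
    inner (dalong M f q w) (g q) + inner (f q) (dalong M g q w).
Proof.
move=> sf sg Mq Uq Tw.
have [V1 [f1 [V1o V1q V1U sf1 ff1]]] := smooth_along_ext sf Mq Uq.
have [V2 [g2 [V2o V2q V2U sg2 gg2]]] := smooth_along_ext sg Mq Uq.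
have df1 := smooth_differentiable sf1 V1q.
have dg2 := smooth_differentiable sg2 V2q.
rewrite (dalongE Tw V1o V1q ff1 df1) (dalongE Tw V2o V2q gg2 dg2).
rewrite ff1 // gg2 //; have [di <-] := derive_inner w df1 dg2.
apply: (dalongE Tw (openI V1o V2o)) => //.
by move=> x Mx [V1x V2x]; rewrite ff1 // gg2.
Qed.

End AlongSubmanifold.

(** * The tangent projector *)

Section TangentProjector.
Context {R : realType} {n k : nat}.
Local Notation vec := 'rV[R]_(n + k).
Variables (M U : set vec) (E : 'I_n -> vec -> vec) (N : 'I_k -> vec -> vec).
Hypotheses (M_sub : embedded_submanifold M) (Uo : open U).
Hypothesis EN : adapted_frame M U E N.

Definition tan_proj (x : vec) : 'M[R]_(n + k) := frame_proj (E^~ x).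

Local Notation P := tan_proj.

Lemma smooth_frame_proj d (e : 'I_d -> vec -> vec) (O : set vec) : open O ->
  (forall i, smooth_on O (e i)) -> smooth_on O (fun x => frame_proj (e^~ x)).
Proof.
move=> Oo se; apply: smooth_sum => // i; apply: smooth_mulmx => //.
exact: (smooth_linmx (@trmx R 1 (n + k)) Oo).
Qed.

Lemma smooth_tan_proj : smooth_on U P.
Proof. by apply: smooth_frame_proj => // i; exact: (af_smoothE EN). Qed.

Lemma orthonormalE q : U q -> Defs.orthonormal (E^~ q).
Proof. by move=> Uq i j; have := af_orthonormal EN Uq (inl i) (inl j). Qed.

Lemma orthonormalN q : U q -> Defs.orthonormal (N^~ q).
Proof. by move=> Uq i j; have := af_orthonormal EN Uq (inr i) (inr j). Qed.

Lemma tan_projT q : (P q)^T = P q.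
Proof. exact: frame_proj_sym. Qed.

Lemma tan_projK q : U q -> P q *m P q = P q.
Proof. by move=> /orthonormalE; exact: frame_proj_idem. Qed.

Lemma tan_projE i q : U q -> E i q *m P q = E i q.
Proof. by move=> /orthonormalE; exact: (@frame_proj_fix _ _ _ (E^~ q)). Qed.

Lemma tan_projN l q : U q -> N l q *m P q = 0.
Proof.
move=> Uq; rewrite mul_frame_proj big1 // => i _.
by rewrite (af_orthonormal EN Uq (inr l) (inl i)) scale0r.
Qed.

Lemma nor_projE q : U q -> 1%:M - P q = frame_proj (N^~ q).
Proof.
move=> /(af_orthonormal EN)/frame_proj_join <-.
by rewrite addrAC subrr add0r.
Qed.

Lemma tangent0 q : M q -> tangent M q 0.
Proof.
move=> Mq; exists (cst q); split => //; first by rewrite derive1_cst.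
exists setT; split => //; first exact: openT.
exact: smooth_cst.
Qed.

(** If [w] is tangent, it is orthogonal to the normal fields, hence equal to its
    projection; conversely the projection is a combination of the [E_i q]. *)
Lemma tangentP q w : M q -> U q -> tangent M q w <-> w *m P q = w.
Proof.
move=> Mq Uq; split=> [Tw|<-].
  apply/eqP; rewrite eq_sym -subr_eq0 -[X in X - _]mulmx1 -mulmxBr nor_projE //.
  rewrite mul_frame_proj big1 // => l _.
  by rewrite innerC (af_normal EN) // scale0r.
rewrite mul_frame_proj; elim/big_ind : _ => [|u u' Tu Tu'|i _].
- exact: tangent0.
- by rewrite -[u]scale1r; exact: tangent_linear.
- rewrite -[_ *: _]addr0; apply: tangent_linear => //; last exact: tangent0.
  exact: (af_tangent EN).
Qed.

End TangentProjector.

(** * The Levi-Civita connection *)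

Lemma addr_subr_opp (V : zmodType) (a b c d : V) :
  a + b = c + d -> a - c = - (b - d).
Proof. move=> e; apply/eqP; rewrite opprB subr_eq addrAC eq_sym subr_eq.
by rewrite [d + c]addrC e. Qed.

Lemma subr_swap (V : zmodType) (a b c d : V) : a - b = c - d -> a - c = b - d.
Proof. move=> e; apply/eqP; rewrite subr_eq addrAC eq_sym subr_eq.
by rewrite addrC -(subrK b a) e addrAC subrK. Qed.

(** Applying the two symmetries in turn permutes the arguments and ends at the
    initial term with the opposite sign. *)
Lemma sym_antisym0 (R : realType) (T : Type) (D : T -> Prop) (S : T -> T -> T -> R) :
  (forall a b c, D a -> D b -> D c -> S a b c = - S a c b) ->
  (forall a b c, D a -> D b -> S a b c = S b a c) ->
  forall a b c, D a -> D b -> D c -> S a b c = 0.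
Proof.
move=> anti sym a b c Da Db Dc.
have : S a b c = - S a b c.
  rewrite {1}anti // (sym a c) // anti // opprK (sym c b) // anti //.
  by rewrite (sym b a).
by move/eqP; rewrite -addr_eq0 -mulr2n mulrn_eq0 /= => /eqP.
Qed.

(** From here on [P] is any smooth field of orthogonal projectors whose fixed
    vectors on [M] are the tangent ones; its construction is forgotten. *)
Section ProjectorCalculus.
Context {R : realType} {m : nat}.
Local Notation vec := 'rV[R]_m.
Variables (M U : set vec) (P : vec -> 'M[R]_m).
Hypotheses (Uo : open U) (sP : smooth_on U P).
Hypothesis PT : forall q, (P q)^T = P q.
Hypothesis PK : forall q, U q -> P q *m P q = P q.
Hypothesis TP : forall q w, M q -> U q -> tangent M q w <-> w *m P q = w.

Lemma tprojE q u : M q -> U q -> tproj M q u = u *m P q.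
Proof.
move=> Mq Uq; apply: xget_unique => [|w [Tw uw]].
  split; first by apply/TP => //; rewrite -mulmxA PK.
  move=> t /TP-/(_ Mq Uq) <-.
  by rewrite -{2}PT -inner_mulmxl mulmxBl -mulmxA PK // subrr inner0l.
have wP : w *m P q = w by apply/TP.
have Td : tangent M q (u *m P q - w).
  by apply/TP => //; rewrite mulmxBl -mulmxA PK // wP.
apply/eqP; rewrite -subr_eq0 -oppr_eq0 opprB; apply/eqP; apply: inner_eq0.
have := uw _ Td; rewrite -[X in inner _ X](_ : (u *m P q - w) *m (P q)^T = _).
  by rewrite -inner_mulmxl mulmxBl wP.
by rewrite PT mulmxBl -mulmxA PK // wP.
Qed.

Lemma nprojE q u : M q -> U q -> nproj M q u = u - u *m P q.
Proof. by move=> Mq Uq; rewrite /nproj tprojE. Qed.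

Lemma vector_field_proj X : smooth_along M U X ->
  (forall q, M q -> U q -> X q *m P q = X q) -> vector_field M U X.
Proof. by move=> sX XP; split=> // q Mq Uq; apply/TP => //; exact: XP. Qed.

(** Derivatives of the projector, from [P^2 = P = P^T]: the derivative of [P]
    exchanges tangent and normal vectors. *)
Lemma derive_projT q a : U q -> ('D_a P q)^T = 'D_a P q.
Proof.
move=> Uq; have dP := smooth_differentiable sP Uq.
rewrite -[LHS](derive_linmx (@trmx R m m)) //.
by congr ('D_a _ q); rewrite funeqE => x /=; rewrite PT.
Qed.

Lemma derive_projK q a : U q ->
  'D_a P q = 'D_a P q *m P q + P q *m 'D_a P q.
Proof.
move=> Uq; have dP := smooth_differentiable sP Uq.
rewrite -derive_mulmx //; apply: (derive_open _ Uo Uq) => x Ux.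
by rewrite PK.
Qed.

Lemma tan_dP q a (u : vec) : U q -> u *m P q = u -> u *m 'D_a P q *m P q = 0.
Proof.
move=> Uq uP; have := congr1 (mulmx u) (derive_projK a Uq).
rewrite mulmxDr !mulmxA uP => /eqP.
by rewrite -subr_eq subrr eq_sym => /eqP.
Qed.

Lemma nor_dP q a (u : vec) : U q -> u *m P q = 0 ->
  u *m 'D_a P q *m P q = u *m 'D_a P q.
Proof.
move=> Uq uP; have := congr1 (mulmx u) (derive_projK a Uq).
by rewrite mulmxDr !mulmxA uP mul0mx addr0.
Qed.

Lemma smooth_cst_mulmx c (A : 'M[R]_(c, m)) : smooth_on U (fun x => A *m P x).
Proof.
exact: (@smooth_mulmx _ _ _ _ _ U (cst A) P Uo (smooth_cst U A) sP).
Qed.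

Lemma derive_cst_mulmx c (A : 'M[R]_(c, m)) q a : U q ->
  'D_a (fun x => A *m P x) q = A *m 'D_a P q.
Proof.
move=> Uq; have dP := smooth_differentiable sP Uq.
by rewrite derive_mulmx // derive_cst mul0mx add0r.
Qed.

(** Differentiating [Y P = Y]: the derivative of a tangent field splits into the
    derivative of the projector, which is its normal part, and a tangent part. *)
Lemma dalong_tangent Y q a : vector_field M U Y -> M q -> U q -> tangent M q a ->
  dalong M Y q a = dalong M Y q a *m P q + Y q *m 'D_a P q.
Proof.
move=> [sY TY] Mq Uq Ta; have saP : smooth_along M U P := smooth_on_along Uo sP.
rewrite -(dalong_smooth Uo sP Uq Ta) -(dalong_mulmx Uo sY saP) //.
by apply: (dalong_eq Ta Uo Uq) => x Mx Ux; apply/esym/TP => //; exact: TY.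
Qed.

(** Likewise from [eta P = 0]. *)
Lemma dalong_normal (eta : vec -> vec) (q a : vec) : smooth_along M U eta ->
  (forall x, M x -> U x -> eta x *m P x = 0) ->
  M q -> U q -> tangent M q a ->
  dalong M eta q a *m P q = - (eta q *m 'D_a P q).
Proof.
move=> se eP Mq Uq Ta; have saP : smooth_along M U P := smooth_on_along Uo sP.
apply/eqP; rewrite -subr_eq0 opprK; apply/eqP.
rewrite -(dalong_smooth Uo sP Uq Ta) -(dalong_mulmx Uo se saP) //.
rewrite (dalong_eq (g := cst 0) Ta Uo Uq); last by move=> x Mx Ux; exact: eP.
rewrite (dalongE (g := cst 0) Ta Uo Uq) // ?derive_cst //.
Qed.

Variable nabla : (vec -> vec) -> (vec -> vec) -> vec -> vec.
Hypothesis LC : levi_civita M nabla.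

(** The symmetry of the second fundamental form: the bracket of two tangent
    fields is a difference of covariant derivatives, hence tangent. *)
Lemma shape_symmetric q a b : M q -> U q -> a *m P q = a -> b *m P q = b ->
  b *m 'D_a P q = a *m 'D_b P q.
Proof.
move=> Mq Uq aP bP.
have cf (c : vec) : vector_field M U (fun x => c *m P x).
  apply: vector_field_proj => [|x Mx Ux]; last by rewrite -mulmxA PK.
  exact: (smooth_on_along Uo (smooth_cst_mulmx c)).
have Ta : tangent M q a by apply/TP.
have Tb : tangent M q b by apply/TP.
have := lc_torsion_free LC Uo (cf a) (cf b) Mq Uq.
have /TP-/(_ Mq Uq) := (lc_field LC Uo (cf a) (cf b)).2 q Mq Uq.
have /TP-/(_ Mq Uq) := (lc_field LC Uo (cf b) (cf a)).2 q Mq Uq.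
move: (nabla _ _ q) (nabla _ _ q) => u w uP wP.
rewrite /mbracket aP bP.
rewrite (dalong_smooth Uo (smooth_cst_mulmx b) Uq Ta).
rewrite (dalong_smooth Uo (smooth_cst_mulmx a) Uq Tb).
rewrite (derive_cst_mulmx b a Uq) (derive_cst_mulmx a b Uq).
move=> e.
have := tan_dP a Uq bP; have := tan_dP b Uq aP; move: e.
move: (b *m _) (a *m _) => s t e tP sP0.
by apply/eqP; rewrite -subr_eq0 -e -wP -uP -mulmxBl e mulmxBl tP sP0 subrr.
Qed.

(** The Levi-Civita connection is the tangential part of the flat one: their
    difference, paired with a third field, is symmetric in the first two arguments
    (both are torsion-free) and antisymmetric in the last two (both are metric),
    hence zero. *)
Lemma nablaE X Y q : vector_field M U X -> vector_field M U Y -> M q -> U q ->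
  nabla X Y q = dalong M Y q (X q) *m P q.
Proof.
move=> vX vY Mq Uq.
(* [u] has to be orthogonal to its own projection [u *m P q], which extends to
   the tangent field [u *m P]. *)
set u := nabla X Y q - dalong M Y q (X q).
have vZ : vector_field M U (fun x => u *m P x).
  apply: vector_field_proj => [|x Mx Ux]; last by rewrite -mulmxA PK.
  exact: (smooth_on_along Uo (smooth_cst_mulmx u)).
have S0 := @sym_antisym0 R _ (vector_field M U)
  (fun A B C => inner (nabla A B q - dalong M B q (A q)) (C q)).
have {}S0 := S0 _ _ _ _ _ vX vY vZ.
have nP : nabla X Y q *m P q = nabla X Y q.
  by apply/TP => //; exact: (lc_field LC Uo vX vY).2.
rewrite -nP; apply/eqP; rewrite -subr_eq0 -mulmxBl -/u; apply/eqP.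
apply: inner_eq0; rewrite inner_mulmxl PT -mulmxA PK //.
apply: S0 => [A B C vA vB vC|A B C vA vB].
  rewrite !innerBl; apply: addr_subr_opp; rewrite (innerC _ (B q)).
  rewrite (innerC (dalong M C q (A q))) -(dalong_inner Uo vB.1 vC.1 Mq Uq (vA.2 q Mq Uq)).
  exact/esym/(lc_metric LC Uo vA vB vC Mq Uq).
by rewrite /= (subr_swap (lc_torsion_free LC Uo vA vB Mq Uq)).
Qed.

End ProjectorCalculus.

(** * Second derivatives at a point *)

(** Identities between sums of row vectors, checked coordinatewise. *)
Ltac zmod := apply/rowP => zmod_j; rewrite !mxE; ring.

Section SecondOrder.
Context {R : realType} {m : nat}.
Local Notation vec := 'rV[R]_m.
Variables (M U : set vec) (P : vec -> 'M[R]_m).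
Hypotheses (Uo : open U) (sP : smooth_on U P).
Hypothesis PT : forall q, (P q)^T = P q.
Hypothesis PK : forall q, U q -> P q *m P q = P q.
Hypothesis TP : forall q w, M q -> U q -> tangent M q w <-> w *m P q = w.
Variable nabla : (vec -> vec) -> (vec -> vec) -> vec -> vec.
Hypothesis LC : levi_civita M nabla.
Variable p : vec.
Hypotheses (Mp : M p) (Up : U p).

Local Notation dP a := ('D_a P p).
Local Notation ddP a b := ('D_a ('D_b P) p).

Let dPp : differentiable P p := smooth_differentiable sP Up.

Lemma linear_ddl c d (f : vec -> 'M[R]_(c, d)) (b : vec) :
  smooth_on U f -> linear (fun a => 'D_a ('D_b f) p).
Proof.
by move=> sf; apply/derive_lin/(smooth_differentiable (smooth_derive b sf)).
Qed.

Lemma linear_ddr c d (f : vec -> 'M[R]_(c, d)) (a : vec) :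
  smooth_on U f -> linear (fun b => 'D_a ('D_b f) p).
Proof.
move=> sf; have -> : (fun b => 'D_a ('D_b f) p) = (fun b => 'D_b ('D_a f) p).
  by apply: funext => b; exact: (derive2C a b Uo Up sf).
exact: (linear_ddl a sf).
Qed.

Lemma smooth_const_field (u : vec) : smooth_on U (fun x => u *m P x).
Proof. exact: smooth_cst_mulmx. Qed.

Lemma derive_const_field (u a : vec) : 'D_a (fun x => u *m P x) p = u *m dP a.
Proof. exact: (derive_cst_mulmx sP u a Up). Qed.

Lemma derive_eq_on (W : normedModType R) (f g : vec -> W) (a : vec) :
  smooth_on U f -> smooth_on U g -> (forall x, M x -> U x -> f x = g x) ->
  a *m P p = a -> 'D_a f p = 'D_a g p.
Proof.
move=> sf sg fg /TP-/(_ Mp Up) Ta.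
rewrite -(dalong_smooth Uo sf Up Ta) -(dalong_smooth Uo sg Up Ta).
exact: (dalong_eq Ta Uo Up).
Qed.

(** [P^2 = P], differentiated twice. *)
Lemma derive_projK2 (a b : vec) :
  ddP a b = ddP a b *m P p + dP b *m dP a + (dP a *m dP b + P p *m ddP a b).
Proof.
have ddPp := smooth_differentiable (smooth_derive b sP) Up.
have e : ddP a b = 'D_a (fun x => 'D_b P x *m P x + P x *m 'D_b P x) p.
  apply: (derive_open a Uo Up) => x Ux; exact: (derive_projK Uo sP PK b Ux).
apply: (etrans e); rewrite -(derive_mulmx a ddPp dPp) -(derive_mulmx a dPp ddPp).
apply: (@deriveD _ _ _ (fun x => 'D_b P x *m P x)).
  exact: (diff_derivable (differentiable_mulmx ddPp dPp)).
exact: (diff_derivable (differentiable_mulmx dPp ddPp)).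
Qed.

(** The second fundamental form is evaluated on the tangent fields [u *m P] and
    [w *m P], with [u] and [w] constant: only [P] contributes derivatives. *)
Lemma smooth_const_II (u w : vec) :
  smooth_on U (fun q => (u *m P q) *m 'D_(w *m P q) P q).
Proof.
apply: (smooth_mulmx Uo (smooth_const_field u)).
exact: (smooth_derive_along Uo (smooth_const_field w) sP).
Qed.

Lemma derive_const_II (u w z : vec) :
  'D_z (fun q => (u *m P q) *m 'D_(w *m P q) P q) p =
  u *m dP z *m dP (w *m P p) + u *m P p *m (ddP z (w *m P p) + dP (w *m dP z)).
Proof.
have du := smooth_differentiable (smooth_const_field u) Up.
have dw := smooth_differentiable (smooth_derive_along Uo (smooth_const_field w) sP) Up.
rewrite (derive_mulmx z du dw) derive_const_field.
rewrite (derive_along z Uo Up (smooth_const_field w) sP).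
by rewrite derive_const_field.
Qed.

(** The Codazzi equation: differentiate along [M] the symmetry of the second
    fundamental form evaluated on projections of constant vectors. *)
Lemma codazzi (y z x : vec) : y *m P p = y -> z *m P p = z -> x *m P p = x ->
  y *m dP z *m dP x + y *m (ddP z x + dP (x *m dP z)) =
  x *m dP z *m dP y + x *m (ddP z y + dP (y *m dP z)).
Proof.
move=> yP zP xP.
have e : 'D_z (fun q => (y *m P q) *m 'D_(x *m P q) P q) p =
         'D_z (fun q => (x *m P q) *m 'D_(y *m P q) P q) p.
  apply: (derive_eq_on (smooth_const_II y x) (smooth_const_II x y) _ zP) => q Mq Uq.
  by apply: (shape_symmetric Uo sP PK TP LC Mq Uq); rewrite -mulmxA PK.
have := etrans (esym (derive_const_II y x z)) (etrans e (derive_const_II x y z)).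
by rewrite yP xP.
Qed.

Lemma tangent_at X q : vector_field M U X -> M q -> U q -> X q *m P q = X q.
Proof. by move=> [_ TX] Mq Uq; apply/TP => //; exact: TX. Qed.

(** A field is only smooth along [M], so [Y] comes with a local extension [Ye], whose
    derivative enters the formula. *)
Lemma nabla_nabla X Y Ye (V : set vec) (Z : vec -> vec) :
  vector_field M U X -> vector_field M U Y ->
  open V -> V p -> V `<=` U -> smooth_on V Ye ->
  (forall x, M x -> V x -> Y x = Ye x) ->
  vector_field M U Z -> smooth_on U Z ->
  nabla X (nabla Y Z) p =
    ('D_(X p) ('D_(Y p) Z) p + 'D_('D_(X p) Ye p) Z p
     + 'D_(Y p) Z p *m dP (X p)) *m P p.
Proof.
move=> vX vY Vo Vp VU sYe YYe vZ sZ.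
have vNYZ := lc_field LC Uo vY vZ.
have Ta := vX.2 p Mp Up.
have sPO := smooth_subset VU sP; have sZO := smooth_subset VU sZ.
have sd := smooth_derive_along Vo sYe sZO.
rewrite (nablaE Uo sP PT PK TP LC vX vNYZ Mp Up).
have dd := smooth_differentiable sd Vp; have dPV := smooth_differentiable sPO Vp.
have Yp := YYe p Mp Vp.
have -> : dalong M (nabla Y Z) p (X p) =
    'D_(X p) (fun q => 'D_(Ye q) Z q *m P q) p.
  apply: (dalongE Ta Vo Vp _ (differentiable_mulmx dd dPV)) => x Mx Vx.
  have Ux := VU x Vx; rewrite (nablaE Uo sP PT PK TP LC vY vZ Mx Ux).
  by rewrite (dalong_smooth Uo sZ Ux (vY.2 x Mx Ux)) (YYe x Mx Vx).
rewrite (derive_mulmx (X p) dd dPV) (derive_along (X p) Vo Vp sYe sZO) -Yp.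
move: ('D_(X p) _ p) ('D_('D_(X p) Ye p) Z p) ('D_(Y p) Z p *m _) => b c d.
by rewrite mulmxDl -mulmxA (PK Up) [RHS]mulmxDl.
Qed.

Lemma nabla_smooth X Z : vector_field M U X ->
  vector_field M U Z -> smooth_on U Z -> nabla X Z p = 'D_(X p) Z p *m P p.
Proof.
move=> vX vZ sZ; rewrite (nablaE Uo sP PT PK TP LC vX vZ Mp Up).
by rewrite (dalong_smooth Uo sZ Up (vX.2 p Mp Up)).
Qed.

Section Field.
Variable v : vec -> vec.
Hypotheses (vM : vector_field M U v) (sv : smooth_on U v).

Local Notation dv a := ('D_a v p).
Local Notation hess a b := ('D_a ('D_b v) p).

Let dvp : differentiable v p := smooth_differentiable sv Up.

Lemma derive_tangent_field (a : vec) : a *m P p = a ->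
  dv a = dv a *m P p + v p *m dP a.
Proof.
move=> /TP-/(_ Mp Up) Ta; rewrite -(dalong_smooth Uo sv Up Ta).
exact: (dalong_tangent Uo sP TP vM Mp Up Ta).
Qed.

(** Second derivatives of a tangent field: differentiate twice [v P = v]. *)
Lemma hess_tangent_field (a : vec) : a *m P p = a ->
  hess a a + dv (a *m dP a) = (hess a a + dv (a *m dP a)) *m P p + dv a *m dP a
    + (dv a *m dP a + v p *m (ddP a a + dP (a *m dP a))).
Proof.
move=> aP.
have sX := smooth_const_field a.
have dX (c d : nat) (f : vec -> 'M[R]_(c, d)) : smooth_on U f ->
    'D_a (fun q => 'D_(a *m P q) f q) p = 'D_a ('D_a f) p + 'D_(a *m dP a) f p.
  by move=> sf; rewrite (derive_along a Uo Up sX sf) aP derive_const_field.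
have sdv := smooth_derive_along Uo sX sv.
have sdP := smooth_derive_along Uo sX sP.
have ddv0 := smooth_differentiable sdv Up.
have ddP0 := smooth_differentiable sdP Up.
have e : 'D_a (fun q => 'D_(a *m P q) v q) p =
       'D_a (fun q => 'D_(a *m P q) v q *m P q + v q *m 'D_(a *m P q) P q) p.
  apply: (derive_eq_on sdv _ _ aP) => [|q Mq Uq].
    apply: (smoothD Uo); first exact: (smooth_mulmx Uo sdv sP).
    exact: (smooth_mulmx Uo sv sdP).
  have Ta : tangent M q (a *m P q) by apply/(TP _ Mq Uq); rewrite -mulmxA PK.
  have dE : dalong M v q (a *m P q) = 'D_(a *m P q) v q.
    exact: (dalong_smooth Uo sv Uq Ta).
  by have := dalong_tangent Uo sP TP vM Mq Uq Ta; rewrite dE.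
have e2 : 'D_a (fun q => 'D_(a *m P q) v q *m P q + v q *m 'D_(a *m P q) P q) p =
    'D_a (fun q => 'D_(a *m P q) v q *m P q) p +
    'D_a (fun q => v q *m 'D_(a *m P q) P q) p.
  apply: (@deriveD _ _ _ (fun q => 'D_(a *m P q) v q *m P q)).
    exact: (diff_derivable (differentiable_mulmx ddv0 dPp)).
  exact: (diff_derivable (differentiable_mulmx dvp ddP0)).
apply: (etrans (esym (dX _ _ v sv))); apply: (etrans e); apply: (etrans e2).
rewrite (derive_mulmx a ddv0 dPp) (derive_mulmx a dvp ddP0).
by rewrite (dX _ _ v sv) (dX _ _ P sP) aP.
Qed.

(** The derivative [DX] of a local extension of [X] depends on the extension only
    through its tangent part, which cancels in [cov2E]. *)
Lemma bochner_term X : vector_field M U X ->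
  exists2 DX : vec, DX = DX *m P p + X p *m dP (X p) &
  nabla X (nabla X v) p - nabla (nabla X X) v p =
    (hess (X p) (X p) + dv DX + dv (X p) *m dP (X p)) *m P p
    - dv (DX *m P p) *m P p.
Proof.
move=> vX; have [V [Xe [Vo Vp VU sXe XXe]]] := smooth_along_ext Uo vX.1 Mp Up.
have Ta := vX.2 p Mp Up.
have dX : dalong M X p (X p) = 'D_(X p) Xe p.
  apply: (dalongE Ta Vo Vp XXe); exact: (smooth_differentiable sXe Vp).
exists ('D_(X p) Xe p).
  by have := dalong_tangent Uo sP TP vX Mp Up Ta; rewrite dX.
rewrite (nabla_nabla vX vX Vo Vp VU sXe XXe vM sv).
rewrite (nabla_smooth (lc_field LC Uo vX vX) vM sv).
by rewrite (nablaE Uo sP PT PK TP LC vX vX Mp Up) dX.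
Qed.

End Field.

Lemma vector_field_mbracket X Y : vector_field M U X -> vector_field M U Y ->
  smooth_on U X -> smooth_on U Y -> vector_field M U (mbracket M X Y).
Proof.
move=> vX vY sX sY.
have sB : smooth_on U (fun q => 'D_(X q) Y q + - 'D_(Y q) X q).
  apply: (smoothD Uo (smooth_derive_along Uo sX sY)).
  exact: (smooth_linmx (-%R : {linear vec -> vec}) Uo (smooth_derive_along Uo sY sX)).
split=> [q Mq Uq|q Mq Uq].
  exists U, (fun q => 'D_(X q) Y q + - 'D_(Y q) X q); split=> [||//|x Mx Ux].
  - exact: Uo.
  - exact: Uq.
  - rewrite /mbracket (dalong_smooth Uo sY Ux (vX.2 x Mx Ux)).
    by rewrite (dalong_smooth Uo sX Ux (vY.2 x Mx Ux)).
have tXY := tangent_at (lc_field LC Uo vX vY) Mq Uq.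
have tYX := tangent_at (lc_field LC Uo vY vX) Mq Uq.
apply/(TP _ Mq Uq); rewrite -(lc_torsion_free LC Uo vX vY Mq Uq).
by rewrite mulmxBl tXY tYX.
Qed.

(** The curvature of [M] in terms of first derivatives only: the second derivatives
    of [Z] cancel by symmetry, those of [X] and [Y] against the bracket. *)
Lemma curvature X Y Z : vector_field M U X -> vector_field M U Y ->
  vector_field M U Z -> smooth_on U X -> smooth_on U Y -> smooth_on U Z ->
  nabla X (nabla Y Z) p - nabla Y (nabla X Z) p - nabla (mbracket M X Y) Z p =
  ('D_(Y p) Z p *m dP (X p) - 'D_(X p) Z p *m dP (Y p)) *m P p.
Proof.
move=> vX vY vZ sX sY sZ.
have UU : U `<=` U by [].
have vB := vector_field_mbracket vX vY sX sY.
rewrite (nabla_nabla vX vY Uo Up UU sY (fun _ _ _ => erefl) vZ sZ).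
rewrite (nabla_nabla vY vX Uo Up UU sX (fun _ _ _ => erefl) vZ sZ).
rewrite (nabla_smooth vB vZ sZ) /mbracket.
rewrite (dalong_smooth Uo sY Up (vX.2 p Mp Up)).
rewrite (dalong_smooth Uo sX Up (vY.2 p Mp Up)).
rewrite (derive2C (X p) (Y p) Uo Up sZ).
have dZ := smooth_differentiable sZ Up.
have -> : 'D_('D_(X p) Y p - 'D_(Y p) X p) Z p =
    'D_('D_(X p) Y p) Z p - 'D_('D_(Y p) X p) Z p.
  have l := derive_lin dZ; rewrite addrC -scaleN1r l scaleN1r addrC.
  by [].
move: ('D_(Y p) ('D_(X p) Z) p) ('D_('D_(X p) Y p) Z p) ('D_('D_(Y p) X p) Z p).
move: ('D_(Y p) Z p *m dP (X p)) ('D_(X p) Z p *m dP (Y p)) (P p) => b c Q d e f.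
rewrite -!mulmxBl; congr (_ *m _); zmod.
Qed.

End SecondOrder.

(** * Tensor algebra at a point *)

Lemma linearD_of (R : realType) (W W' : lmodType R) (f : W -> W') (u w : W) :
  linear f -> f (u + w) = f u + f w.
Proof. by move=> lf; rewrite -[u]scale1r lf !scale1r. Qed.

(** What remains is algebra in one tangent space: the values at [p] of the projector
    and its derivatives are arbitrary matrices subject to the identities already
    established. *)
Section PointwiseAlgebra.
Context {R : realType} {m n k : nat}.
Local Notation vec := 'rV[R]_m.
Variables (P : 'M[R]_m) (dP : vec -> 'M[R]_m) (ddP : vec -> vec -> 'M[R]_m).
Hypothesis dP_linear : linear dP.
Hypothesis tan_dP0 : forall y a : vec, y *m P = y -> y *m dP a *m P = 0.
Hypothesis nor_dPK : forall y a : vec, y *m P = 0 -> y *m dP a *m P = y *m dP a.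
Hypothesis dPT : forall a, (dP a)^T = dP a.
Hypothesis dPC : forall a b : vec, a *m P = a -> b *m P = b ->
  b *m dP a = a *m dP b.
Hypothesis ddPE : forall a b,
  ddP a b = ddP a b *m P + dP b *m dP a + (dP a *m dP b + P *m ddP a b).
Hypothesis ddPC : forall a b, ddP a b = ddP b a.
Hypothesis codazzi0 : forall y z x : vec,
  y *m P = y -> z *m P = z -> x *m P = x ->
  y *m dP z *m dP x + y *m (ddP z x + dP (x *m dP z)) =
  x *m dP z *m dP y + x *m (ddP z y + dP (y *m dP z)).

Variables (e : 'I_n -> vec) (nu : 'I_k -> vec).
Hypothesis eP : forall i, e i *m P = e i.
Hypothesis nuP : forall l, nu l *m P = 0.
Hypothesis P_frame : forall u : vec, \sum_i inner u (e i) *: e i = u *m P.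
Hypothesis P_normal : forall u : vec, u *m P = 0 ->
  u = \sum_l inner u (nu l) *: nu l.

(** The covariant derivative, in the direction [z], of the second fundamental
    form [(x, y) |-> y *m dP x]. *)
Definition dII (y z x : vec) : vec :=
  y *m ddP z x *m (1%:M - P) + y *m dP (x *m dP z).

Lemma nor_dP_tan (y a : vec) : y *m P = y -> y *m dP a *m (1%:M - P) = y *m dP a.
Proof. by move=> yP; rewrite mulmxBr mulmx1 tan_dP0 // subr0. Qed.

(** Two derivatives of the projector in succession lead back to the tangent space. *)
Lemma tan_dPdP (y a b : vec) : y *m P = y ->
  y *m dP a *m dP b *m P = y *m dP a *m dP b.
Proof. by move=> yP; rewrite nor_dPK // tan_dP0. Qed.

Lemma tan_ddP (y a b : vec) : y *m P = y ->
  y *m ddP a b *m P = - (y *m dP b *m dP a + y *m dP a *m dP b).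
Proof.
move=> yP; have := congr1 (mulmx y) (ddPE a b); rewrite !mulmxDr !mulmxA yP.
move: (y *m ddP a b) (y *m dP b *m dP a) (y *m dP a *m dP b) => d c b'.
by move=> h; apply: (addIr d); rewrite {3}h; zmod.
Qed.

Lemma codazzi_dII (y z x : vec) : y *m P = y -> z *m P = z -> x *m P = x ->
  dII y z x = dII x z y.
Proof.
move=> yP zP xP; have := congr1 (mulmx^~ (1%:M - P)) (codazzi0 yP zP xP).
have nQ (u w : vec) : u *m P = u -> u *m dP z *m dP w *m (1%:M - P) = 0.
  by move=> uP; rewrite mulmxBr mulmx1 tan_dPdP // subrr.
have tQ (u w : vec) : u *m P = u -> u *m dP w *m (1%:M - P) = u *m dP w.
  exact: nor_dP_tan.
rewrite /dII /=; move: (1%:M - P) nQ tQ => Q nQ tQ.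
by rewrite !mulmxDl !nQ // !add0r !mulmxDr !mulmxDl !tQ.
Qed.

Lemma dII_sym (y z x : vec) : z *m P = z -> x *m P = x -> dII y z x = dII y x z.
Proof. by move=> zP xP; rewrite /dII (ddPC z x) (dPC zP xP). Qed.

Lemma codazzi_trace (y : vec) : y *m P = y ->
  \sum_i dII (e i) y (e i) = \sum_i dII y (e i) (e i).
Proof.
move=> yP; apply: eq_bigr => i _.
by rewrite (dII_sym (e i)) // (codazzi_dII (eP i) (eP i) yP).
Qed.

(** The derivative along [y] of the unnormalised mean curvature vector: the
    tangent part is minus the Weingarten map, the normal part is the trace of
    the covariant derivative of the second fundamental form. *)
Lemma derive_mean_curvature (y : vec) : y *m P = y ->
  \sum_i (e i *m dP y *m dP (e i)
    + e i *m (ddP y (e i) + dP (e i *m dP y))) =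
  \sum_i dII y (e i) (e i) - (\sum_i e i *m dP (e i)) *m dP y.
Proof.
move=> yP; rewrite -codazzi_trace // mulmx_suml -sumrB; apply: eq_bigr => i _.
rewrite /dII mulmxBr mulmx1 tan_ddP ?eP // mulmxDr.
move: (e i *m dP y *m dP (e i)) (e i *m dP (e i) *m dP y) (e i *m ddP y (e i)).
by move: (e i *m dP (e i *m dP y)) => a b c d; zmod.
Qed.

Section TangentField.
Variables (y : vec) (dv : vec -> vec) (hess : vec -> vec -> vec).
Hypothesis yP : y *m P = y.
Hypothesis dv_linear : linear dv.
Hypothesis dvE : forall a, a *m P = a -> dv a = dv a *m P + y *m dP a.
Hypothesis hessE : forall a, a *m P = a ->
  hess a a + dv (a *m dP a) = (hess a a + dv (a *m dP a)) *m P + dv a *m dP a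
    + (dv a *m dP a + y *m (ddP a a + dP (a *m dP a))).

(** The second covariant derivative of a tangent field [v], as a bilinear
    expression in the values of its arguments. *)
Definition cov2 (a b : vec) : vec :=
  (hess a b + dv (b *m dP a) + dv b *m dP a) *m P.

(** Only the normal part [X *m dP X] of the derivative [DX] of the field survives,
    so the second covariant derivative is tensorial. *)
Lemma cov2E (X DX : vec) : DX = DX *m P + X *m dP X ->
  (hess X X + dv DX + dv X *m dP X) *m P - dv (DX *m P) *m P = cov2 X X.
Proof.
move=> DXE; rewrite {1}DXE (linearD_of _ _ dv_linear) /cov2 -mulmxBl.
congr (_ *m _).
move: (hess X X) (dv X *m _) (dv (X *m _)) (dv (DX *m P)) => a b c d; zmod.
Qed.

Lemma cov2_linearr : (forall u, linear (hess u)) -> forall u, linear (cov2 u).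
Proof.
move=> lh u c a b; rewrite /cov2 lh !mulmxDl -!scalemxAl !(dv_linear, mulmxDl).
rewrite -!scalemxAl.
move: (hess u a *m P) (hess u b *m P) (dv (a *m dP u) *m P) => x1 x2 x3.
move: (dv (b *m dP u) *m P) (dv a *m dP u *m P) (dv b *m dP u *m P) => x4 x5 x6.
by zmod.
Qed.

Lemma cov2_linearl : (forall u, linear (hess^~ u)) -> forall u, linear (cov2^~ u).
Proof.
move=> lh u c a b; rewrite /cov2 lh !dP_linear !mulmxDr -!scalemxAr dv_linear.
rewrite !mulmxDl -!scalemxAl.
move: (hess a u *m P) (hess b u *m P) (dv (u *m dP a) *m P) => x1 x2 x3.
move: (dv (u *m dP b) *m P) (dv u *m dP a *m P) (dv u *m dP b *m P) => x4 x5 x6.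
by zmod.
Qed.

(** The definition of the covariant derivative of the second fundamental form, with
    [va] and [DX] the flat derivatives of the two fields it is evaluated on. *)
Lemma nablaB_algebra (a DX : vec) (va : vec) :
  DX = DX *m P + a *m dP a -> va = va *m P + y *m dP a ->
  va *m dP a + y *m (ddP a a + dP DX)
    - (va *m dP a + y *m (ddP a a + dP DX)) *m P
    - y *m dP (DX *m P) - va *m P *m dP a = dII y a a.
Proof.
move=> DXE vaE.
have e1 : va *m dP a = va *m P *m dP a + y *m dP a *m dP a.
  by rewrite {1}vaE mulmxDl.
have vP : va *m P *m P = va *m P.
  by rewrite {2}vaE mulmxDl tan_dP0 // addr0.
rewrite {1 2}DXE (linearD_of _ _ dP_linear) /dII mulmxBr mulmx1 e1.
rewrite !(mulmxDr y) !(mulmxDl _ _ P) !(tan_dP0 _ yP) tan_dPdP // (tan_dP0 _ vP).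
move: (va *m P *m dP a) (y *m dP a *m dP a) (y *m ddP a a) => b c d.
move: (y *m ddP a a *m P) (y *m dP (DX *m P)) (y *m dP (a *m dP a)) => f g h.
by zmod.
Qed.

Lemma dv_dP_tan (a b : vec) : a *m P = a ->
  dv a *m dP b *m P = y *m dP a *m dP b.
Proof.
move=> aP; rewrite (dvE aP) !mulmxDl tan_dPdP // tan_dP0 ?add0r //.
have := congr1 (mulmx^~ P) (dvE aP); rewrite mulmxDl tan_dP0 // addr0 => <-.
by [].
Qed.

(** The tangent part of [hess a a] comes from [P^2 = P] ([tan_ddP]), the normal part
    from [v P = v]. *)
Lemma hess_split (a : vec) : a *m P = a ->
  hess a a = cov2 a a - y *m dP a *m dP a - dv (a *m dP a) + dII y a a
    + dv a *m P *m dP a *+ 2.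
Proof.
move=> aP.
have e1 : dv a *m dP a = dv a *m P *m dP a + y *m dP a *m dP a.
  by rewrite {1}(dvE aP) mulmxDl.
have -> : hess a a = (hess a a + dv (a *m dP a)) - dv (a *m dP a).
  by rewrite addrK.
rewrite (hessE aP) /cov2 /dII mulmxBr mulmx1 tan_ddP // (mulmxDr y) !mulmxDl.
rewrite dv_dP_tan // e1 mulr2n.
move: (hess a a *m P) (dv (a *m dP a) *m P) (dv a *m P *m dP a) => b c d.
move: (y *m dP (a *m dP a)) (y *m ddP a a) (y *m dP a *m dP a) (dv (a *m dP a)).
by move=> f g h l; zmod.
Qed.

(** The Gauss equation: tangent vectors disappear under [dP] followed by the
    projection, so that only the normal parts [y *m dP b] and [y *m dP a] of the
    derivatives contribute. *)
Lemma gauss (a b : vec) : a *m P = a -> b *m P = b ->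
  (dv b *m dP a - dv a *m dP b) *m P = y *m dP b *m dP a - y *m dP a *m dP b.
Proof. by move=> aP bP; rewrite mulmxBl !dv_dP_tan. Qed.

(** Expand the normal vector [e i *m dP y] in the [nu l], and the tangent vector
    [nu l *m dP y] in the [e i]: both have the coefficients [<e i *m dP y, nu l>]. *)
Lemma weingarten_squares :
  \sum_l nu l *m dP (nu l *m dP y) = \sum_i y *m dP (e i) *m dP (e i).
Proof.
pose L : {linear vec -> 'M[R]_m} := HB.pack dP (GRing.isLinear.Build _ _ _ _ _ dP_linear).
have dPsum (c : 'I_n -> R) : dP (\sum_i c i *: e i) = \sum_i c i *: dP (e i).
  by rewrite -[dP]/(L : _ -> _) linear_sum; apply: eq_bigr => i _; rewrite linearZ.
transitivity (\sum_l \sum_i inner (e i *m dP y) (nu l) *: (nu l *m dP (e i))).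
  apply: eq_bigr => l _; rewrite -{1}(nor_dPK y (nuP l)) -P_frame dPsum mulmx_sumr.
  by apply: eq_bigr => i _; rewrite -scalemxAr inner_mulmxl dPT innerC.
rewrite exchange_big; apply: eq_bigr => i _ /=; rewrite (dPC (eP i) yP).
transitivity ((\sum_l inner (e i *m dP y) (nu l) *: nu l) *m dP (e i)).
  by rewrite mulmx_suml; apply: eq_bigr => l _; rewrite scalemxAl.
by rewrite -(P_normal (tan_dP0 y (eP i))).
Qed.

(** Contracting the Gauss equation, after moving the symmetric matrices [dP] across
    the inner product. *)
Lemma ricci_trace :
  \sum_j (\sum_i inner (e j *m dP y *m dP (e i) - e j *m dP (e i) *m dP y) (e i))
    *: e j =
  (\sum_i e i *m dP (e i)) *m dP y - \sum_i y *m dP (e i) *m dP (e i).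
Proof.
set w := RHS.
have wP : w *m P = w.
  rewrite /w mulmxBl !mulmx_suml; congr (_ - _); apply: eq_bigr => i _.
    by rewrite tan_dPdP.
  by rewrite tan_dPdP.
rewrite -wP -P_frame; apply: eq_bigr => j _; congr (_ *: _).
rewrite /w mulmx_suml -sumrB inner_suml; apply: eq_bigr => i _.
rewrite !innerBl; congr (_ - _).
  by rewrite [LHS]inner_mulmxl dPT [LHS]inner_mulmxl dPT innerC.
rewrite (dPC (eP i) yP) [LHS]inner_mulmxl dPT [LHS]inner_mulmxl dPT.
by rewrite innerC.
Qed.

End TangentField.

End PointwiseAlgebra.

(** * Extrinsic geometry *)
(** Since [f] only enters through its projector it may be replaced by [e] and [nu]
    together, and the vectors of [nu] contribute nothing. *)
Lemma trace_of_const_II (R : realType) (d n k m : nat) (P A : 'M[R]_m)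
    (D DD : 'rV[R]_m -> 'M[R]_m) (f : 'I_d -> 'rV[R]_m)
    (e : 'I_n -> 'rV[R]_m) (nu : 'I_k -> 'rV[R]_m) :
  linear D -> linear DD ->
  (forall i, e i *m P = e i) -> (forall l, nu l *m P = 0) ->
  frame_proj f = frame_proj e + frame_proj nu ->
  \sum_j (f j *m A *m D (f j *m P) + f j *m P *m (DD (f j *m P) + D (f j *m A))) =
  \sum_i (e i *m A *m D (e i) + e i *m (DD (e i) + D (e i *m A))).
Proof.
move=> lD lDD eP nuP fE.
pose b (u w : 'rV[R]_m) :=
  u *m A *m D (w *m P) + u *m P *m (DD (w *m P) + D (w *m A)).
have br u : linear (b u).
  move=> c x y; rewrite /b !mulmxDl -!scalemxAl !lD lDD !mulmxDr -!scalemxAr.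
  move: (u *m A *m D (x *m P)) (u *m A *m D (y *m P)) (u *m P *m DD (x *m P)).
  move: (u *m P *m DD (y *m P)) (u *m P *m D (x *m A)) (u *m P *m D (y *m A)).
  by move=> x1 x2 x3 x4 x5 x6; zmod.
have bl u : linear (b^~ u).
  move=> c x y; rewrite /b !mulmxDl -!scalemxAl.
  move: (x *m A *m _) (y *m A *m _) (x *m P *m _) (y *m P *m _) => x1 x2 x3 x4.
  by zmod.
rewrite -[LHS]/(\sum_j b (f j) (f j)) (trace_frame_join br bl fE).
have D0 : D 0 = 0.
  by apply: (addIr (D 0)); rewrite add0r -{3}(addr0 0) (linearD_of 0 0 lD).
rewrite [X in _ + X]big1 ?addr0 => [|l _].
  by apply: eq_bigr => i _; rewrite /b eP.
by rewrite /b nuP D0 mulmx0 mul0mx addr0.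
Qed.

Lemma linear_sum_of (R : realType) (W W' : lmodType R) (f : W -> W') (I : Type)
    (s : seq I) (F : I -> W) :
  linear f -> f (\sum_(i <- s) F i) = \sum_(i <- s) f (F i).
Proof.
move=> lf; elim: s => [|i s IHs]; last by rewrite !big_cons linearD_of // IHs.
by rewrite !big_nil; apply: (addIr (f 0)); rewrite add0r -linearD_of // addr0.
Qed.

Lemma sum_rearrange (R : realType) (m : nat) (a b c d e f g : 'rV[R]_m) :
  - (a - b - c + d + e *+ 2 + (f - g)) = - a + b + c - f + g - d - 2 *: e.
Proof. by rewrite mulr2n; zmod. Qed.

Lemma collect_normal (R : realType) (m : nat) (a b c d e u : 'rV[R]_m) (x y z : R) :
  a + b + c - d + (e + x *: u) - y *: u - 2 *: (z *: u) =
  a + b + c - d + e - (2 * z + y - x) *: u.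
Proof. by zmod. Qed.

Section Extrinsic.
Context {R : realType} {n k : nat}.
Local Notation vec := 'rV[R]_(n + k).
Variables (M U : set vec) (P : vec -> 'M[R]_(n + k)).
Hypotheses (Uo : open U) (sP : smooth_on U P).
Hypothesis PT : forall q, (P q)^T = P q.
Hypothesis PK : forall q, U q -> P q *m P q = P q.
Hypothesis TP : forall q w, M q -> U q -> tangent M q w <-> w *m P q = w.
Variable nabla : (vec -> vec) -> (vec -> vec) -> vec -> vec.
Hypothesis LC : levi_civita M nabla.

Variables (E : 'I_n -> vec -> vec) (N : 'I_k -> vec -> vec).
Hypothesis sE : forall i, smooth_on U (E i).
Hypothesis sN : forall l, smooth_on U (N l).
Hypothesis EP : forall i q, U q -> E i q *m P q = E i q.
Hypothesis NP : forall l q, U q -> N l q *m P q = 0.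
Hypothesis P_E : forall q, frame_proj (E^~ q) = P q.
Hypothesis P_EN : forall q, U q -> frame_proj (E^~ q) + frame_proj (N^~ q) = 1%:M.
Hypothesis orthoE : forall q, U q -> Defs.orthonormal (E^~ q).

Lemma frame_field i : vector_field M U (E i).
Proof.
by apply: (vector_field_proj TP) => [|q Mq Uq]; [exact: (smooth_on_along Uo (sE i)) | exact: EP].
Qed.

Lemma second_ffE X Y q : vector_field M U Y -> M q -> U q ->
  X q *m P q = X q -> second_ff M X Y q = Y q *m 'D_(X q) P q.
Proof.
move=> vY Mq Uq XP; have Ta : tangent M q (X q) by apply/(TP _ Mq Uq).
rewrite /second_ff (nprojE PT PK TP _ Mq Uq).
rewrite {1}(dalong_tangent Uo sP TP vY Mq Uq Ta).
by rewrite addrAC subrr add0r.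
Qed.

Lemma weingartenE (eta : vec -> vec) q a : smooth_along M U eta ->
  (forall x, M x -> U x -> eta x *m P x = 0) ->
  M q -> U q -> a *m P q = a -> weingarten M eta q a = eta q *m 'D_a P q.
Proof.
move=> se eP Mq Uq aP; have Ta : tangent M q a by apply/(TP _ Mq Uq).
rewrite /weingarten (tprojE PT PK TP _ Mq Uq).
by rewrite (dalong_normal Uo sP se eP Mq Uq Ta) opprK.
Qed.

Lemma mean_curvature_vectorE q : M q -> U q ->
  mean_curvature_vector M E q = n%:R^-1 *: \sum_i E i q *m 'D_(E i q) P q.
Proof.
move=> Mq Uq; congr (_ *: _); apply: eq_bigr => i _.
by apply: (second_ffE (frame_field i) Mq Uq); exact: EP.
Qed.

(** The trace of the second fundamental form written with the standard basis:
    unlike the adapted frame it is constant, so that only [P] has to be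
    differentiated. *)
Lemma trace_IIE q : U q ->
  \sum_i E i q *m 'D_(E i q) P q =
  \sum_j ((delta_mx 0 j : vec) *m P q) *m 'D_((delta_mx 0 j : vec) *m P q) P q.
Proof.
move=> Uq; have dPq := smooth_differentiable sP Uq.
have lD := derive_lin dPq.
pose b (u w : vec) := (u *m P q) *m 'D_(w *m P q) P q.
have br u : linear (b u).
  by move=> c x y; rewrite /b mulmxDl -scalemxAl lD mulmxDr -scalemxAr.
have bl u : linear (b^~ u).
  by move=> c x y; rewrite /b mulmxDl -scalemxAl mulmxDl -scalemxAl.
have full := frame_proj_full (@orthonormal_delta R (n + k)).
rewrite -[RHS]/(\sum_j b (delta_mx 0 j) (delta_mx 0 j)).
rewrite (trace_frame_join (e := E^~ q) (e' := N^~ q) br bl); last first.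
  by rewrite full P_EN.
rewrite [X in _ + X]big1 ?addr0 => [|l _]; last by rewrite /b NP // mul0mx.
by apply: eq_bigr => i _; rewrite /b EP.
Qed.

Definition trace_II (q : vec) : vec :=
  \sum_j ((delta_mx 0 j : vec) *m P q) *m 'D_((delta_mx 0 j : vec) *m P q) P q.

Lemma smooth_trace_II : smooth_on U trace_II.
Proof. by apply: (smooth_sum _ Uo) => j; exact: (smooth_const_II Uo sP). Qed.

Variable p : vec.
Hypotheses (Mp : M p) (Up : U p).

Local Notation dP a := ('D_a P p).
Local Notation ddP a b := ('D_a ('D_b P) p).

Let dPp : differentiable P p := smooth_differentiable sP Up.

Lemma derive_trace_II z :
  'D_z trace_II p = \sum_i (E i p *m dP z *m dP (E i p)
    + E i p *m (ddP z (E i p) + dP (E i p *m dP z))).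
Proof.
have lD : linear (fun a => dP a) := derive_lin dPp.
have lDD : linear (fun a => ddP z a) := linear_ddr Uo Up z sP.
transitivity (\sum_j ((delta_mx 0 j : vec) *m dP z *m dP ((delta_mx 0 j : vec) *m P p)
  + (delta_mx 0 j : vec) *m P p *m (ddP z ((delta_mx 0 j : vec) *m P p)
                                  + dP ((delta_mx 0 j : vec) *m dP z)))).
  have -> : trace_II = \sum_j (fun q => ((delta_mx 0 j : vec) *m P q)
      *m 'D_((delta_mx 0 j : vec) *m P q) P q).
    by apply: funext => q; rewrite fct_sumE.
  rewrite derive_sum => [|j].
    by apply: eq_bigr => j _; exact: (derive_const_II Uo sP Up).
  by apply: diff_derivable; exact: (smooth_differentiable (smooth_const_II Uo sP _ _) Up).
have full := frame_proj_full (@orthonormal_delta R (n + k)).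
apply: (@trace_of_const_II R _ n k _ (P p) (dP z) (fun a => dP a)
  (fun a => ddP z a) (fun j => delta_mx 0 j) (E^~ p) (N^~ p) lD lDD);
  last by rewrite full P_EN.
- by move=> i; exact: EP.
- by move=> l; exact: NP.
Qed.

Lemma weingarten_mean_curvature a : a *m P p = a ->
  weingarten M (mean_curvature_vector M E) p a =
  n%:R^-1 *: (\sum_i E i p *m dP (E i p)) *m dP a.
Proof.
move=> aP.
have nP q : U q -> trace_II q *m P q = 0.
  move=> Uq; rewrite /trace_II -trace_IIE // mulmx_suml big1 // => i _.
  by rewrite (tan_dP Uo sP PK _ Uq) // EP.
have He q : M q -> U q -> mean_curvature_vector M E q = n%:R^-1 *: trace_II q.
  by move=> Mq Uq; rewrite mean_curvature_vectorE // trace_IIE.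
rewrite weingartenE //.
- by rewrite He // /trace_II -trace_IIE.
- move=> q Mq Uq; exists U, (fun q => n%:R^-1 *: trace_II q); split=> //.
  apply: (smooth_linmx ( *:%R n%:R^-1 : {linear vec -> vec}) Uo).
  exact: smooth_trace_II.
- by move=> q Mq Uq; rewrite He // -scalemxAl nP // scaler0.
Qed.

Lemma derive_mean_curvature_ext (Hext : vec -> vec) a :
  a *m P p = a -> smooth_on U Hext ->
  (forall q, M q -> U q -> Hext q = mean_curvature_vector M E q) ->
  'D_a Hext p = n%:R^-1 *: 'D_a trace_II p.
Proof.
move=> aP sH He; have sT := smooth_trace_II.
rewrite -(derive_linmx ( *:%R n%:R^-1 : {linear vec -> vec})); last first.
  exact: (smooth_differentiable sT Up).
apply: (derive_eq_on Uo TP Mp Up sH _ _ aP) => [|q Mq Uq /=].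
  exact: (smooth_linmx ( *:%R n%:R^-1 : {linear vec -> vec}) Uo sT).
by rewrite He // mean_curvature_vectorE // trace_IIE.
Qed.

Let dP_lin : linear (fun a : vec => dP a) := derive_lin dPp.
Let tan0 (y a : vec) : y *m P p = y -> y *m dP a *m P p = 0.
Proof. exact: (tan_dP Uo sP PK a Up). Qed.
Let norK (y a : vec) : y *m P p = 0 -> y *m dP a *m P p = y *m dP a.
Proof. exact: (nor_dP Uo sP PK a Up). Qed.
Let dPsym (a : vec) : (dP a)^T = dP a.
Proof. exact: (derive_projT sP PT a Up). Qed.
Let dPC (a b : vec) : a *m P p = a -> b *m P p = b -> b *m dP a = a *m dP b.
Proof. exact: (shape_symmetric Uo sP PK TP LC Mp Up). Qed.
Let ddPE (a b : vec) :
  ddP a b = ddP a b *m P p + dP b *m dP a + (dP a *m dP b + P p *m ddP a b).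
Proof. exact: (derive_projK2 Uo sP PK Up). Qed.
Let ddPC (a b : vec) : ddP a b = ddP b a.
Proof. exact: (derive2C a b Uo Up sP). Qed.
Let cod (y z x : vec) : y *m P p = y -> z *m P p = z -> x *m P p = x ->
  y *m dP z *m dP x + y *m (ddP z x + dP (x *m dP z)) =
  x *m dP z *m dP y + x *m (ddP z y + dP (y *m dP z)).
Proof. exact: (codazzi Uo sP PK TP LC Mp Up). Qed.
Let eP i : E i p *m P p = E i p. Proof. exact: EP. Qed.
Let nP l : N l p *m P p = 0. Proof. exact: NP. Qed.

Local Notation DII := (dII (P p) (fun a : vec => dP a) (fun a b : vec => ddP a b)).

Variable v : vec -> vec.
Hypotheses (vM : vector_field M U v) (sv : smooth_on U v).

Local Notation dv a := ('D_a v p).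
Local Notation hess a b := ('D_a ('D_b v) p).
Local Notation Cov2 := (cov2 (P p) (fun a : vec => dP a) (fun a : vec => dv a)
  (fun a b : vec => hess a b)).

Let dvp : differentiable v p := smooth_differentiable sv Up.

Lemma flat_term (X : vec -> vec) : smooth_on U X ->
  flat X (flat X v) p - flat (flat X X) v p = hess (X p) (X p).
Proof.
move=> sX; rewrite /flat (derive_along (X p) Uo Up sX sv).
by move: ('D_(X p) ('D_(X p) v) p) ('D_('D_(X p) X p) v p) => a b; rewrite addrK.
Qed.

(** The frame [F] is exchanged for the adapted one, then only the normal vectors
    are turned back into fields. *)
Lemma flat_bochner (F : 'I_(n + k) -> vec -> vec) :
  (forall a, smooth_on U (F a)) -> Defs.orthonormal (F^~ p) ->
  bochner flat F v p =
    - (\sum_i hess (E i p) (E i p)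
       + (\sum_l flat (N l) (flat (N l) v) p - \sum_l flat (flat (N l) (N l)) v p)).
Proof.
move=> sF oF; rewrite /bochner -(sumrB _ _ (fun l => flat (N l) (flat (N l) v) p)).
congr (- _).
have -> : \sum_l (flat (N l) (flat (N l) v) p - flat (flat (N l) (N l)) v p) =
    \sum_l hess (N l p) (N l p).
  by apply: eq_bigr => l _; exact: (flat_term (sN l)).
have -> : \sum_a (flat (F a) (flat (F a) v) p - flat (flat (F a) (F a)) v p) =
    \sum_a hess (F a p) (F a p).
  by apply: eq_bigr => l _; exact: (flat_term (sF l)).
apply: (@trace_frame_join _ _ _ _ _ _ (fun a b : vec => hess a b) (F^~ p) (E^~ p) (N^~ p)).
- by move=> u; exact: (linear_ddr Uo Up u sv).
- by move=> u; exact: (linear_ddl Up u sv).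
- by rewrite (frame_proj_full oF) (P_EN Up).
Qed.

Lemma nabla_bochner (G : 'I_n -> vec -> vec) :
  (forall i, vector_field M U (G i)) -> Defs.orthonormal (G^~ p) ->
  bochner nabla G v p = - \sum_i Cov2 (E i p) (E i p).
Proof.
move=> vG oG; rewrite /bochner; congr (- _).
have tG i : G i p *m P p = G i p by apply/(TP _ Mp Up); exact: (vG i).2.
transitivity (\sum_i Cov2 (G i p) (G i p)).
  apply: eq_bigr => i _.
  have [DX DXE ->] := bochner_term Uo sP PT PK TP LC Mp Up vM sv (vG i).
  exact: (cov2E (dP := fun a : vec => dP a) (fun a b : vec => hess a b) (derive_lin dvp) DXE).
have lD := dP_lin; have lv : linear (fun a : vec => dv a) := derive_lin dvp.
have lr u : linear (fun b : vec => hess u b) := linear_ddr Uo Up u sv.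
have ll u : linear (fun b : vec => hess b u) := linear_ddl Up u sv.
have pG : frame_proj (G^~ p) = frame_proj (E^~ p).
  by apply: (frame_proj_change oG (orthoE Up)) => i; rewrite P_E.
exact: (@trace_frame _ _ _ _ _ Cov2 (G^~ p) (E^~ p) (cov2_linearr _ _ lv lr)
  (cov2_linearl _ lD lv ll) pG).
Qed.

Lemma second_ff_nabla i :
  second_ff M (E i) (nabla (E i) v) p = dv (E i p) *m P p *m dP (E i p).
Proof.
rewrite (second_ffE (lc_field LC Uo (frame_field i) vM) Mp Up (eP i)).
by rewrite (nabla_smooth Uo sP PT PK TP LC Mp Up (frame_field i) vM sv).
Qed.

Lemma nablaB_term i :
  nablaB M nabla (second_ff M) (E i) (E i) v p = DII (v p) (E i p) (E i p).
Proof.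
have vE := frame_field i; have Ta := vE.2 p Mp Up.
have vP : v p *m P p = v p by exact: (tangent_at TP vM Mp Up).
rewrite /nablaB second_ff_nabla.
have tD : nabla (E i) (E i) p = 'D_(E i p) (E i) p *m P p.
  exact: (nabla_smooth Uo sP PT PK TP LC Mp Up vE vE (sE i)).
have tDP : nabla (E i) (E i) p *m P p = nabla (E i) (E i) p.
  by rewrite tD -mulmxA (PK Up).
rewrite (second_ffE vM Mp Up tDP) tD.
rewrite /normal_connection (nprojE PT PK TP _ Mp Up).
have sII : smooth_on U (fun q => v q *m 'D_(E i q) P q).
  exact: (smooth_mulmx Uo sv (smooth_derive_along Uo (sE i) sP)).
have dDP := smooth_differentiable (smooth_derive_along Uo (sE i) sP) Up.
have -> : dalong M (second_ff M (E i) v) p (E i p) =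
    dv (E i p) *m dP (E i p)
    + v p *m (ddP (E i p) (E i p) + dP ('D_(E i p) (E i) p)).
  rewrite -(derive_along (E i p) Uo Up (sE i) sP) -(derive_mulmx _ dvp dDP).
  apply: (dalongE Ta Uo Up) => [q Mq Uq|]; last exact: (smooth_differentiable sII Up).
  by apply: (second_ffE vM Mq Uq); exact: EP.
have eD : 'D_(E i p) (E i) p = 'D_(E i p) (E i) p *m P p + E i p *m dP (E i p).
  exact: (derive_tangent_field Uo sP TP Mp Up vE (sE i) (eP i)).
have dvE : dv (E i p) = dv (E i p) *m P p + v p *m dP (E i p).
  exact: (derive_tangent_field Uo sP TP Mp Up vM sv (eP i)).
exact: (nablaB_algebra (fun a b : vec => ddP a b) dP_lin tan0 norK vP eD dvE).
Qed.

Lemma ricci_sharpE : ricci_sharp M nabla E v p =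
  (\sum_i E i p *m dP (E i p)) *m dP (v p)
  - \sum_i v p *m dP (E i p) *m dP (E i p).
Proof.
have vP : v p *m P p = v p by exact: (tangent_at TP vM Mp Up).
rewrite -(ricci_trace (e := E^~ p) tan0 norK dPsym dPC eP _ vP); last first.
  by move=> u; rewrite -mul_frame_proj P_E.
apply: eq_bigr => j _; congr (_ *: _); apply: eq_bigr => i _; congr inner.
rewrite (curvature Uo sP PT PK TP LC Mp Up (frame_field i) vM (frame_field j)
  (sE i) sv (sE j)).
apply: (gauss (P := P p) (dP := fun a : vec => dP a)
  (dv := fun a : vec => 'D_a (E j) p) tan0 norK _ _ (eP i) vP).
  exact: eP.
by move=> a aP; exact: (derive_tangent_field Uo sP TP Mp Up (frame_field j) (sE j) aP).
Qed.

Let vP : v p *m P p = v p. Proof. exact: (tangent_at TP vM Mp Up). Qed.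

Let dvE (a : vec) : a *m P p = a -> dv a = dv a *m P p + v p *m dP a.
Proof. exact: (derive_tangent_field Uo sP TP Mp Up vM sv). Qed.

Let hessE (a : vec) : a *m P p = a ->
  hess a a + dv (a *m dP a) = (hess a a + dv (a *m dP a)) *m P p + dv a *m dP a
    + (dv a *m dP a + v p *m (ddP a a + dP (a *m dP a))).
Proof. exact: (hess_tangent_field Uo sP PK TP Mp Up vM sv). Qed.

Lemma trace_hess :
  \sum_i hess (E i p) (E i p) = \sum_i Cov2 (E i p) (E i p)
    - \sum_i v p *m dP (E i p) *m dP (E i p)
    - dv (\sum_i E i p *m dP (E i p))
    + \sum_i DII (v p) (E i p) (E i p)
    + (\sum_i second_ff M (E i) (nabla (E i) v) p) *+ 2.
Proof.
have lv : linear (fun a : vec => dv a) := derive_lin dvp.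
rewrite (linear_sum_of _ _ lv) -sumrMnl -!sumrB -!big_split.
apply: eq_bigr => i _; rewrite second_ff_nabla.
exact: (hess_split (hess := fun a b : vec => hess a b)
  (ddP := fun a b : vec => ddP a b) tan0 norK ddPE vP dvE hessE (eP i)).
Qed.

Lemma sum_weingarten_squares :
  \sum_l weingarten M (N l) p (weingarten M (N l) p (v p)) =
  \sum_i v p *m dP (E i p) *m dP (E i p).
Proof.
have wN l (a : vec) : a *m P p = a -> weingarten M (N l) p a = N l p *m dP a.
  move=> aP; apply: (weingartenE (smooth_on_along Uo (sN l)) _ Mp Up aP).
  by move=> x _ Ux; exact: NP.
transitivity (\sum_l N l p *m dP (N l p *m dP (v p))).
  apply: eq_bigr => l _; rewrite (wN l _ vP) wN //.
  by rewrite (norK _ (nP l)).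
apply: (weingarten_squares (dP := fun a : vec => dP a) (e := E^~ p) dP_lin tan0
  norK dPsym dPC eP nP _ _ vP).
  by move=> u; rewrite -mul_frame_proj P_E.
move=> u uP; rewrite -mul_frame_proj.
have -> : frame_proj (N^~ p) = 1%:M - P p.
  by rewrite -(P_EN Up) P_E addrAC subrr add0r.
by rewrite mulmxBr mulmx1 uP subr0.
Qed.

Lemma tr_nablaBE :
  tr_nablaB_II M nabla E v p = \sum_i DII (v p) (E i p) (E i p).
Proof. by apply: eq_bigr => i _; exact: nablaB_term. Qed.

Lemma derive_trace_II_split :
  'D_(v p) trace_II p = tr_nablaB_II M nabla E v p
    - (\sum_i E i p *m dP (E i p)) *m dP (v p).
Proof.
rewrite derive_trace_II tr_nablaBE.
exact: (derive_mean_curvature (e := E^~ p) (ddP := fun a b : vec => ddP a b)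
  tan0 norK dPC ddPE ddPC cod eP vP).
Qed.

Section Formulas.
Hypothesis n_gt0 : (0 < n)%N.
Variables (F : 'I_(n + k) -> vec -> vec) (G : 'I_n -> vec -> vec).
Hypotheses (sF : forall a, smooth_on U (F a)) (oF : Defs.orthonormal (F^~ p)).
Hypotheses (vG : forall i, vector_field M U (G i)) (oG : Defs.orthonormal (G^~ p)).

Local Notation H := (mean_curvature_vector M E).

Lemma scale_nVn (W : lmodType R) (u : W) : n%:R *: (n%:R^-1 *: u) = u.
Proof. by rewrite scalerA mulfV ?scale1r // pnatr_eq0 -lt0n. Qed.

Lemma flat_mean_curvature : n%:R *: flat H v p = dv (\sum_i E i p *m dP (E i p)).
Proof.
rewrite /flat (mean_curvature_vectorE Mp Up).
move: (\sum_i _) => u; rewrite -[_ *: u]addr0.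
have lv := derive_lin dvp; rewrite lv (derive0 v p) addr0.
exact: scale_nVn.
Qed.

Lemma bochner_formula :
  bochner flat F v p =
    bochner nabla G v p
    + \sum_(l < k) weingarten M (N l) p (weingarten M (N l) p (v p))
    + n%:R *: flat H v p
    - \sum_(l < k) flat (N l) (flat (N l) v) p
    + \sum_(l < k) flat (flat (N l) (N l)) v p
    - tr_nablaB_II M nabla E v p
    - 2 *: \sum_(i < n) second_ff M (E i) (nabla (E i) v) p.
Proof.
rewrite (flat_bochner sF oF) (nabla_bochner vG oG) trace_hess.
rewrite sum_weingarten_squares tr_nablaBE flat_mean_curvature.
exact: sum_rearrange.
Qed.

Lemma ricci_formula : ricci_sharp M nabla E v p =
  n%:R *: weingarten M H p (v p)
  - \sum_(l < k) weingarten M (N l) p (weingarten M (N l) p (v p)).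
Proof.
rewrite ricci_sharpE sum_weingarten_squares (weingarten_mean_curvature vP).
by rewrite -scalemxAl scale_nVn.
Qed.

(** [D_v H] splits into its tangent part, the Weingarten map, and its normal part,
    given by the Codazzi equation. *)
Lemma bracket_mean_curvature (Hext : vec -> vec) : smooth_on U Hext ->
  (forall q, M q -> U q -> Hext q = H q) ->
  n%:R *: bracket Hext v p = n%:R *: flat H v p
    - tr_nablaB_II M nabla E v p + n%:R *: weingarten M H p (v p).
Proof.
move=> sH He; rewrite /bracket scalerBr (derive_mean_curvature_ext vP sH He).
rewrite scale_nVn derive_trace_II_split (weingarten_mean_curvature vP).
rewrite -scalemxAl scale_nVn (He p Mp Up) /flat.
by rewrite opprB addrA addrAC.
Qed.

End Formulas.

(** * Hypersurfaces *)

(** The codimension stays a variable, constrained to be 1, so that the general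
    results apply as they are. *)
Section Hypersurface.
Variable nu : vec -> vec.
Hypotheses (k1 : k = 1%N) (Nnu : forall l, N l = nu) (n_gt0 : (0 < n)%N).
Hypothesis snu : smooth_on U nu.
Hypothesis nuP : forall q, U q -> nu q *m P q = 0.
Hypothesis nu1 : forall q, U q -> inner (nu q) (nu q) = 1.

Lemma sum_const1 (W : nmodType) (w : W) : \sum_(l < k) w = w.
Proof. by rewrite sumr_const card_ord k1. Qed.

Lemma normal_line q u : U q -> u *m P q = 0 -> u = inner u (nu q) *: nu q.
Proof.
move=> Uq uP; have pN : frame_proj (N^~ q) = 1%:M - P q.
  by rewrite -(P_EN Uq) P_E addrAC subrr add0r.
have : u *m frame_proj (N^~ q) = u by rewrite pN mulmxBr mulmx1 uP subr0.
rewrite mul_frame_proj => {1}<-.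
under eq_bigr do rewrite Nnu.
exact: sum_const1.
Qed.

Lemma tangent_of_perp q u : U q -> inner u (nu q) = 0 -> u *m P q = u.
Proof.
move=> Uq u0; have uP : (u - u *m P q) *m P q = 0.
  by rewrite mulmxBl -mulmxA (PK Uq) subrr.
apply/esym/eqP; rewrite -subr_eq0 (normal_line Uq uP) innerBl u0 inner_mulmxl PT.
by rewrite nuP // innerC inner0l subr0 scale0r.
Qed.

Lemma derive_nu_perp q a : U q -> inner ('D_a nu q) (nu q) = 0.
Proof.
move=> Uq; have dnu := smooth_differentiable snu Uq.
have [_ e] := derive_inner a dnu dnu.
have : 'D_a (fun y => inner (nu y) (nu y) : R^o) q = 0.
  rewrite (derive_open (g := cst (1 : R^o)) a Uo Uq); first exact: derive_cst.
  exact: nu1.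
rewrite e (innerC (nu q)) -mulr2n => /eqP.
by rewrite mulrn_eq0 /= => /eqP.
Qed.

Lemma weingarten_nu q a : M q -> U q -> a *m P q = a ->
  weingarten M nu q a = nu q *m 'D_a P q.
Proof.
move=> Mq Uq; apply: (weingartenE (smooth_on_along Uo snu) _ Mq Uq).
by move=> x _ Ux; exact: nuP.
Qed.

Lemma weingarten_derive a : a *m P p = a -> weingarten M nu p a = - 'D_a nu p.
Proof.
move=> aP; have Ta : tangent M p a by apply/(TP _ Mp Up).
rewrite /weingarten (tprojE PT PK TP _ Mp Up) (dalong_smooth Uo snu Up Ta).
by rewrite (tangent_of_perp Up (derive_nu_perp a Up)).
Qed.

Lemma second_ff_line (y a : vec) : y *m P p = y ->
  y *m dP a = inner y (nu p *m dP a) *: nu p.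
Proof.
move=> yP; rewrite {1}(normal_line Up (tan0 a yP)); congr (_ *: _).
by rewrite inner_mulmxl dPsym.
Qed.

Variable kappa : vec -> 'I_n -> R.
Hypothesis kappa_pc :
  forall q, M q -> U q -> principal_curvatures M nu q (kappa q).
Hypothesis E_eigen : forall i, weingarten M nu p (E i p) = kappa p i *: E i p.

Local Notation H := (mean_curvature kappa).

Lemma nu_dP i : nu p *m dP (E i p) = kappa p i *: E i p.
Proof. by rewrite -E_eigen weingarten_nu. Qed.

Lemma second_ff_eigen i (y : vec) : y *m P p = y ->
  y *m dP (E i p) = (kappa p i * inner y (E i p)) *: nu p.
Proof.
move=> yP; rewrite (second_ff_line _ yP) nu_dP; congr (_ *: _).
by rewrite innerC innerZl innerC.
Qed.

Lemma mean_curvatureM q : n%:R * H q = \sum_i kappa q i.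
Proof. by rewrite /mean_curvature mulrA mulfV ?mul1r // pnatr_eq0 -lt0n. Qed.

Lemma trace_II_line : \sum_i E i p *m dP (E i p) = (n%:R * H p) *: nu p.
Proof.
rewrite mean_curvatureM scaler_suml; apply: eq_bigr => i _.
by rewrite second_ff_eigen // (orthoE Up i i) eqxx mulr1.
Qed.

(** The sum of the principal curvatures is a trace, so it does not depend on the
    eigenbasis and is the normal component of a smooth field. *)
Lemma mean_curvature_inner q : M q -> U q ->
  H q = inner (nu q) (n%:R^-1 *: trace_II q).
Proof.
move=> Mq Uq; have [e [oe te we]] := kappa_pc Mq Uq.
have eP' i : e i *m P q = e i by apply/(TP _ Mq Uq).
rewrite innerC innerZl /mean_curvature; congr (_ * _).
rewrite /trace_II -(trace_IIE Uq) inner_suml.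
have dPq := smooth_differentiable sP Uq; have lD := derive_lin dPq.
pose b (u w : vec) : R^o := inner u (nu q *m 'D_w P q).
have br u : linear (b u).
  by move=> c x y; rewrite /b lD mulmxDr -scalemxAr innerC innerDl innerZl !(innerC _ u).
have bl u : linear (b^~ u).
  by move=> c x y; rewrite /b innerDl innerZl.
have pe : frame_proj e = frame_proj (E^~ q).
  by apply: (frame_proj_change oe (orthoE Uq)) => i; rewrite P_E.
transitivity (\sum_i b (e i) (e i)).
  apply: eq_bigr => i _; rewrite /b -(weingarten_nu Mq Uq (eP' i)) we.
  by rewrite innerC innerZl (oe i i) eqxx mulr1.
rewrite (trace_frame br bl pe); apply: eq_bigr => i _.
by rewrite /b -[in LHS](derive_projT sP PT _ Uq) -inner_mulmxl.
Qed.

Lemma tr_nablaB_normal : tr_nablaB_II M nabla E v p *m P p = 0.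
Proof.
rewrite tr_nablaBE mulmx_suml big1 // => i _.
rewrite /dII mulmxDl tan0 // -mulmxA mulmxBl mul1mx (PK Up) subrr mulmx0.
by rewrite addr0.
Qed.

Lemma tr_nablaB_line : tr_nablaB_II M nabla E v p =
  inner (nu p) (tr_nablaB_II M nabla E v p) *: nu p.
Proof. by rewrite {1}(normal_line Up tr_nablaB_normal) innerC. Qed.

Lemma inner_nu_tan (u : vec) : u *m P p = u -> inner (nu p) u = 0.
Proof. by move=> <-; rewrite innerC inner_mulmxl PT nuP // innerC inner0l. Qed.

Lemma inner_normal_part (a b c : vec) :
  inner (nu p) a - inner (nu p) b - inner (nu p) c =
  inner (a - a *m P p - b - c) (nu p).
Proof.
rewrite !innerBl inner_mulmxl PT nuP // (innerC a 0) inner0l subr0.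
by rewrite !(innerC _ (nu p)).
Qed.

(** [N] being a unit field, its derivative is tangent and only the derivative of the
    mean curvature vector contributes, whose normal part is known. *)
Lemma dalong_mean_curvature :
  n%:R * (dalong (W := R^o) M H p (v p) : R) =
  inner (nu p) (tr_nablaB_II M nabla E v p).
Proof.
have Tv : tangent M p (v p) by apply/(TP _ Mp Up).
pose T q := n%:R^-1 *: trace_II q.
have sT : smooth_on U T.
  exact: (smooth_linmx ( *:%R n%:R^-1 : {linear vec -> vec}) Uo smooth_trace_II).
have -> : dalong (W := R^o) M H p (v p) =
    dalong (W := R^o) M (fun q => inner (nu q) (T q)) p (v p).
  by apply: (dalong_eq Tv Uo Up) => q Mq Uq; exact: mean_curvature_inner.
rewrite (dalong_inner Uo (smooth_on_along Uo snu) (smooth_on_along Uo sT) Mp Up Tv).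
rewrite (dalong_smooth Uo snu Up Tv) (dalong_smooth Uo sT Up Tv).
have -> : 'D_(v p) T p = n%:R^-1 *: 'D_(v p) trace_II p.
  apply: (derive_linmx ( *:%R n%:R^-1 : {linear vec -> vec})).
  exact: (smooth_differentiable smooth_trace_II Up).
have -> : inner ('D_(v p) nu p) (T p) = 0.
  rewrite /T /trace_II -(trace_IIE Up) trace_II_line innerC !innerZl innerC.
  by rewrite (derive_nu_perp _ Up) !mulr0.
rewrite add0r innerC innerZl mulrA mulfV ?mul1r; last by rewrite pnatr_eq0 -lt0n.
rewrite derive_trace_II_split innerBl trace_II_line -scalemxAl innerZl.
rewrite -(weingarten_nu Mp Up vP) [X in _ - _ * X]innerC inner_nu_tan; last first.
  by rewrite weingarten_nu // norK // nuP.
by rewrite mulr0 subr0 innerC.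
Qed.

Lemma div_hE : div_h M nabla E nu v p = inner (nu p) (tr_nablaB_II M nabla E v p).
Proof.
rewrite innerC inner_suml; apply: eq_bigr => i _.
have vE := frame_field i; have Ta := vE.2 p Mp Up.
have sII : smooth_on U (fun q => v q *m 'D_(E i q) P q).
  exact: (smooth_mulmx Uo sv (smooth_derive_along Uo (sE i) sP)).
have saII : smooth_along M U (second_ff M (E i) v).
  move=> q Mq Uq; exists U, (fun q => v q *m 'D_(E i q) P q); split => //.
  by move=> x Mx Ux; apply: (second_ffE vM Mx Ux); exact: EP.
have II0 : inner ('D_(E i p) nu p) (second_ff M (E i) v p) = 0.
  rewrite (second_ffE vM Mp Up (eP i)) (second_ff_eigen i vP) innerC innerZl.
  by rewrite (innerC (nu p)) (derive_nu_perp _ Up) mulr0.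
have dh : dalong (W := R^o) M (scalar_ff M nu (E i) v) p (E i p) =
    inner (nu p) (dalong M (second_ff M (E i) v) p (E i p)).
  apply: (etrans (dalong_inner Uo (smooth_on_along Uo snu) saII Mp Up Ta)).
  by rewrite (dalong_smooth Uo snu Up Ta) II0 add0r.
rewrite dh; apply: (etrans (inner_normal_part _ _ _)); congr inner.
by rewrite /nablaB /normal_connection (nprojE PT PK TP _ Mp Up).
Qed.

(** The Christoffel symbols are antisymmetric in the frame indices, so they cancel
    the derivative of [E i]. *)
Lemma cov_compE i : cov_comp M nabla E v i i p = inner (dv (E i p)) (E i p).
Proof.
have vE := frame_field i; have Ta := vE.2 p Mp Up.
rewrite /cov_comp (dalong_inner Uo vM.1 vE.1 Mp Up Ta).
rewrite (dalong_smooth Uo sv Up Ta) (dalong_smooth Uo (sE i) Up Ta).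
rewrite -[RHS]addr0 -addrA; congr (_ + _).
have dE j := smooth_differentiable (sE j) Up.
have G j : christoffel nabla E i i j p = - inner ('D_(E i p) (E i) p) (E j p).
  rewrite /christoffel (nabla_smooth Uo sP PT PK TP LC Mp Up vE (frame_field j) (sE j)).
  rewrite inner_mulmxl PT eP.
  have [_ e] := derive_inner (E i p) (dE j) (dE i).
  have : 'D_(E i p) (fun y => inner (E j y) (E i y) : R^o) p = 0.
    rewrite (derive_open (g := cst ((j == i)%:R : R^o)) _ Uo Up); first exact: derive_cst.
    by move=> q Uq; exact: (orthoE Uq j i).
  by rewrite e (innerC (E j p)) => /eqP; rewrite addr_eq0 => /eqP.
under eq_bigr do rewrite G mulNr.
rewrite sumrN; apply/eqP; rewrite subr_eq0; apply/eqP.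
rewrite -{1}vP -P_E mul_frame_proj inner_suml; apply: eq_bigr => j _.
by rewrite innerZl mulrC innerC.
Qed.

Lemma sum_second_ff : \sum_(i < n) second_ff M (E i) (nabla (E i) v) p =
  (\sum_i kappa p i * cov_comp M nabla E v i i p) *: nu p.
Proof.
rewrite scaler_suml; apply: eq_bigr => i _; rewrite second_ff_nabla.
rewrite second_ff_eigen; last by rewrite -mulmxA (PK Up).
by rewrite cov_compE inner_mulmxl PT eP.
Qed.

Lemma flat_nu_field : vector_field M U (flat nu nu).
Proof.
have sD : smooth_on U (flat nu nu) := smooth_derive_along Uo snu snu.
apply: (vector_field_proj TP) => [|q Mq Uq]; first exact: (smooth_on_along Uo sD).
exact: (tangent_of_perp Uq (derive_nu_perp _ Uq)).
Qed.

Lemma scalar_ff_flat :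
  scalar_ff M nu (flat nu nu) v p = inner (nu p) (v p *m dP (flat nu nu p)) /\
  scalar_ff M nu v (flat nu nu) p = inner (nu p) (v p *m dP (flat nu nu p)).
Proof.
have wP := tangent_at TP flat_nu_field Mp Up.
rewrite /scalar_ff (second_ffE vM Mp Up wP) (second_ffE flat_nu_field Mp Up vP).
by rewrite (dPC vP wP).
Qed.

Lemma flat_flat_nu : flat (flat nu nu) v p =
  nabla (flat nu nu) v p + inner (nu p) (v p *m dP (flat nu nu p)) *: nu p.
Proof.
have wP := tangent_at TP flat_nu_field Mp Up.
rewrite (nabla_smooth Uo sP PT PK TP LC Mp Up flat_nu_field vM sv).
rewrite {1}/flat {1}(dvE wP) {1}(normal_line Up (tan0 _ vP)); congr (_ + _ *: _).
exact: innerC.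
Qed.

Variables (F : 'I_(n + k) -> vec -> vec) (G : 'I_n -> vec -> vec).
Hypotheses (sF : forall a, smooth_on U (F a)) (oF : Defs.orthonormal (F^~ p)).
Hypotheses (vG : forall i, vector_field M U (G i)) (oG : Defs.orthonormal (G^~ p)).

Local Notation s := (weingarten M nu p).
Local Notation c := (inner (nu p) (v p *m dP (flat nu nu p))).
Local Notation q := (\sum_(i < n) kappa p i * cov_comp M nabla E v i i p).
Local Notation d := (inner (nu p) (tr_nablaB_II M nabla E v p)).

Lemma hypersurface_formula :
  bochner flat F v p =
    bochner nabla G v p + s (s (v p)) + (n%:R * H p) *: flat nu v p
    - flat nu (flat nu v) p + nabla (flat nu nu) v p - (2 * q + d - c) *: nu p.
Proof.
rewrite (bochner_formula n_gt0 sF oF vG oG).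
have -> : \sum_(l < k) weingarten M (N l) p (weingarten M (N l) p (v p)) = s (s (v p)).
  by under eq_bigr do rewrite Nnu; exact: sum_const1.
have -> : \sum_(l < k) flat (N l) (flat (N l) v) p = flat nu (flat nu v) p.
  by under eq_bigr do rewrite Nnu; exact: sum_const1.
have -> : \sum_(l < k) flat (flat (N l) (N l)) v p = flat (flat nu nu) v p.
  by under eq_bigr do rewrite Nnu; exact: sum_const1.
have -> : n%:R *: flat (mean_curvature_vector M E) v p = (n%:R * H p) *: flat nu v p.
  rewrite (flat_mean_curvature n_gt0) trace_II_line -[_ *: nu p]addr0.
  by rewrite (derive_lin dvp) (derive0 v p) addr0.
rewrite flat_flat_nu sum_second_ff {1}tr_nablaB_line.
exact: collect_normal.
Qed.

(** With [D_v N = - s v] and [W_(H N) v = H (s v)], the Ricci formula exchanges the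
    two shapes of the tangent terms. *)
Lemma hypersurface_ricci :
  s (s (v p)) + (n%:R * H p) *: flat nu v p =
  - ricci_sharp M nabla E v p + (n%:R * H p) *: bracket nu v p.
Proof.
have -> : bracket nu v p = flat nu v p + s (v p).
  by rewrite (weingarten_derive vP).
rewrite (ricci_formula n_gt0).
have -> : \sum_(l < k) weingarten M (N l) p (weingarten M (N l) p (v p)) = s (s (v p)).
  by under eq_bigr do rewrite Nnu; exact: sum_const1.
rewrite (weingarten_mean_curvature vP) -scalemxAl (scale_nVn n_gt0).
rewrite trace_II_line -scalemxAl -(weingarten_nu Mp Up vP) scalerDr opprB.
by rewrite addrACA addNr addr0.
Qed.

End Hypersurface.

End Extrinsic.

(** * The Bochner Laplacian formulas *)

Lemma four_formulas (R : realType) (m : nat) (L a w h b r t x f g : 'rV[R]_m) i :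
  L = a + w + x - f + g - t - i -> r = h - w -> b = x - t + h ->
  [/\ L = a + w - h + b - f + g - i, L = a - r + b - f + g - i,
      L = a + w + x - f + g - t - i & L = a - r + h + x - f + g - t - i].
Proof. by move=> -> -> ->; split; zmod. Qed.

Lemma four_formulas_hypersurface (R : realType) (m : nat)
    (L a s x f g r b u : 'rV[R]_m) (q d d1 d2 c c1 c2 : R) :
  L = a + s + x - f + g - (2 * q + d - c) *: u -> s + x = - r + b ->
  d1 = d -> d2 = d -> c1 = c -> c2 = c ->
  [/\ L = a + s + x - f + g - (2 * q + d1 - c1) *: u,
      L = a - r + b - f + g - (2 * q + d1 - c1) *: u,
      L = a + s + x - f + g - (d2 + 2 * q - c2) *: u &
      L = a - r + b - f + g - (d2 + 2 * q - c1) *: u].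
Proof.
move=> -> e -> -> -> ->.
have -> : a - r + b = a + s + x by rewrite -!addrA e.
by split=> //; congr (_ - _ *: _); rewrite [d + _]addrC.
Qed.

Theorem corollary1p12 (R : realType) (n : nat) (n_ge2 : (2 <= n)%N) :
  (forall (k : nat) (k_ge1 : (1 <= k)%N)
     (M : set 'rV[R]_(n + k)) (M_sub : embedded_submanifold M)
     (nabla : ('rV[R]_(n + k) -> 'rV[R]_(n + k)) ->
              ('rV[R]_(n + k) -> 'rV[R]_(n + k)) ->
              'rV[R]_(n + k) -> 'rV[R]_(n + k))
     (nabla_LC : levi_civita M nabla)
     (p : 'rV[R]_(n + k)) (Mp : M p)
     (U : set 'rV[R]_(n + k)) (U_open : open U) (Up : U p)
     (E : 'I_n -> 'rV[R]_(n + k) -> 'rV[R]_(n + k))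
     (N : 'I_k -> 'rV[R]_(n + k) -> 'rV[R]_(n + k))
     (EN_frame : adapted_frame M U E N)
     (F : 'I_(n + k) -> 'rV[R]_(n + k) -> 'rV[R]_(n + k))
     (F_frame : ambient_frame U F)
     (G : 'I_n -> 'rV[R]_(n + k) -> 'rV[R]_(n + k))
     (G_frame : tangent_frame M U G)
     (v : 'rV[R]_(n + k) -> 'rV[R]_(n + k))
     (v_field : vector_field M setT v) (v_smooth : smooth_on U v)
     (Hext : 'rV[R]_(n + k) -> 'rV[R]_(n + k)) (Hext_smooth : smooth_on U Hext)
     (Hext_eq : forall q, M q -> U q -> Hext q = mean_curvature_vector M E q),
   let W := weingarten M in
   let H := mean_curvature_vector M E in
   [/\ bochner flat F v p =
         bochner nabla G v p
         + \sum_(l < k) W (N l) p (W (N l) p (v p))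
         - n%:R *: W H p (v p)
         + n%:R *: bracket Hext v p
         - \sum_(l < k) flat (N l) (flat (N l) v) p
         + \sum_(l < k) flat (flat (N l) (N l)) v p
         - 2 *: \sum_(i < n) second_ff M (E i) (nabla (E i) v) p,
       bochner flat F v p =
         bochner nabla G v p
         - ricci_sharp M nabla E v p
         + n%:R *: bracket Hext v p
         - \sum_(l < k) flat (N l) (flat (N l) v) p
         + \sum_(l < k) flat (flat (N l) (N l)) v p
         - 2 *: \sum_(i < n) second_ff M (E i) (nabla (E i) v) p,
       bochner flat F v p =
         bochner nabla G v p
         + \sum_(l < k) W (N l) p (W (N l) p (v p))
         + n%:R *: flat H v p
         - \sum_(l < k) flat (N l) (flat (N l) v) p
         + \sum_(l < k) flat (flat (N l) (N l)) v p
         - tr_nablaB_II M nabla E v p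
         - 2 *: \sum_(i < n) second_ff M (E i) (nabla (E i) v) p
     & bochner flat F v p =
         bochner nabla G v p
         - ricci_sharp M nabla E v p
         + n%:R *: W H p (v p)
         + n%:R *: flat H v p
         - \sum_(l < k) flat (N l) (flat (N l) v) p
         + \sum_(l < k) flat (flat (N l) (N l)) v p
         - tr_nablaB_II M nabla E v p
         - 2 *: \sum_(i < n) second_ff M (E i) (nabla (E i) v) p])
  /\
  (forall (M : set 'rV[R]_(n + 1)) (M_sub : embedded_submanifold M)
     (nabla : ('rV[R]_(n + 1) -> 'rV[R]_(n + 1)) ->
              ('rV[R]_(n + 1) -> 'rV[R]_(n + 1)) ->
              'rV[R]_(n + 1) -> 'rV[R]_(n + 1))
     (nabla_LC : levi_civita M nabla)
     (p : 'rV[R]_(n + 1)) (Mp : M p)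
     (U : set 'rV[R]_(n + 1)) (U_open : open U) (Up : U p)
     (E : 'I_n -> 'rV[R]_(n + 1) -> 'rV[R]_(n + 1))
     (N : 'rV[R]_(n + 1) -> 'rV[R]_(n + 1))
     (EN_frame : adapted_frame M U E (fun _ : 'I_1 => N))
     (F : 'I_(n + 1) -> 'rV[R]_(n + 1) -> 'rV[R]_(n + 1))
     (F_frame : ambient_frame U F)
     (G : 'I_n -> 'rV[R]_(n + 1) -> 'rV[R]_(n + 1))
     (G_frame : tangent_frame M U G)
     (v : 'rV[R]_(n + 1) -> 'rV[R]_(n + 1))
     (v_field : vector_field M setT v) (v_smooth : smooth_on U v)
     (kappa : 'rV[R]_(n + 1) -> 'I_n -> R)
     (kappa_pc : forall q, M q -> U q -> principal_curvatures M N q (kappa q))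
     (E_eigen : forall i, weingarten M N p (E i p) = kappa p i *: E i p),
   let s := weingarten M N p in
   let h := scalar_ff M N in
   let H := mean_curvature kappa in
   [/\ bochner flat F v p =
         bochner nabla G v p + s (s (v p))
         + (n%:R * H p) *: flat N v p
         - flat N (flat N v) p
         + nabla (flat N N) v p
         - (2 * \sum_(i < n) kappa p i * cov_comp M nabla E v i i p
            + n%:R * (dalong (W := R^o) M H p (v p) : R)
            - h v (flat N N) p) *: N p,
       bochner flat F v p =
         bochner nabla G v p - ricci_sharp M nabla E v p
         + (n%:R * H p) *: bracket N v p
         - flat N (flat N v) p
         + nabla (flat N N) v p
         - (2 * \sum_(i < n) kappa p i * cov_comp M nabla E v i i p
            + n%:R * (dalong (W := R^o) M H p (v p) : R)
            - h v (flat N N) p) *: N p,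
       bochner flat F v p =
         bochner nabla G v p + s (s (v p))
         + (n%:R * H p) *: flat N v p
         - flat N (flat N v) p
         + nabla (flat N N) v p
         - (div_h M nabla E N v p
            + 2 * \sum_(i < n) kappa p i * cov_comp M nabla E v i i p
            - h (flat N N) v p) *: N p
     & bochner flat F v p =
         bochner nabla G v p - ricci_sharp M nabla E v p
         + (n%:R * H p) *: bracket N v p
         - flat N (flat N v) p
         + nabla (flat N N) v p
         - (div_h M nabla E N v p
            + 2 * \sum_(i < n) kappa p i * cov_comp M nabla E v i i p
            - h v (flat N N) p) *: N p]).
Proof.
have n_gt0 : (0 < n)%N by exact: ltnW.
split.
- move=> k _ M M_sub nabla LC p Mp U Uo Up E N EN F [sF oF] G [vG oG] v [sv tv] v_smooth.
  move=> Hext sH He W H.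
  have vM : vector_field M U v by split=> q Mq _; [exact: sv|exact: tv].
  have sP := smooth_tan_proj Uo EN.
  have TP := tangentP M_sub EN.
  have PT := tan_projT E.
  have PK := tan_projK EN.
  have EP i q := @tan_projE _ _ _ _ _ _ _ EN i q.
  have NP l q := @tan_projN _ _ _ _ _ _ _ EN l q.
  have sE := af_smoothE EN.
  have sN := af_smoothN EN.
  have PE q : frame_proj (E^~ q) = tan_proj E q := erefl.
  have PEN q (Uq : U q) := frame_proj_join (af_orthonormal EN Uq).
  have oE := orthonormalE EN.
  move: (tan_proj E) sP TP PT PK EP NP PE => P sP TP PT PK EP NP PE.
  have third := bochner_formula Uo sP PT PK TP LC sE sN EP NP PE PEN oE Mp Up vM
    v_smooth n_gt0 sF (oF p Up) vG (oG p Mp Up).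
  have ric := ricci_formula Uo sP PT PK TP LC sE sN EP NP PE PEN Mp Up vM
    v_smooth n_gt0.
  have br := bracket_mean_curvature Uo sP PT PK TP LC sE EP NP PEN Mp Up vM
    v_smooth n_gt0 sH He.
  exact: (four_formulas third ric br).
- move=> M M_sub nabla LC p Mp U Uo Up E N EN F [sF oF] G [vG oG] v [sv tv] v_smooth.
  move=> kappa kappa_pc E_eigen s h H.
  have vM : vector_field M U v by split=> q Mq _; [exact: sv|exact: tv].
  have sP := smooth_tan_proj Uo EN.
  have TP := tangentP M_sub EN.
  have PT := tan_projT E.
  have PK := tan_projK EN.
  have EP i q := @tan_projE _ _ _ _ _ _ _ EN i q.
  have NP l q := @tan_projN _ _ _ _ _ _ _ EN l q.
  have sE := af_smoothE EN.
  have sN := af_smoothN EN.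
  have PE q : frame_proj (E^~ q) = tan_proj E q := erefl.
  have PEN q (Uq : U q) := frame_proj_join (af_orthonormal EN Uq).
  have oE := orthonormalE EN.
  move: (tan_proj E) sP TP PT PK EP NP PE => P sP TP PT PK EP NP PE.
  have snu : smooth_on U N := sN ord0.
  have nuP q (Uq : U q) : N q *m P q = 0 := NP ord0 q Uq.
  have nu1 q (Uq : U q) : inner (N q) (N q) = 1 := orthonormalN EN Uq ord0 ord0.
  have NN (l : 'I_1) : (fun _ : 'I_1 => N) l = N := erefl.
  have main := hypersurface_formula Uo sP PT PK TP LC sE sN EP NP PE PEN oE Mp Up vM
    v_smooth erefl NN n_gt0 snu nuP nu1 E_eigen sF (oF p Up) vG (oG p Mp Up).
  have ric := hypersurface_ricci Uo sP PT PK TP LC sE sN EP NP PE PEN oE Mp Up vM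
    v_smooth erefl NN n_gt0 snu nuP nu1 E_eigen.
  have dH := dalong_mean_curvature Uo sP PT PK TP LC sE EP NP PE PEN oE Mp Up vM
    v_smooth erefl NN n_gt0 snu nuP nu1 kappa_pc E_eigen.
  have dh := div_hE Uo sP PT PK TP nabla sE EP PE PEN Mp Up vM
    v_smooth erefl NN snu nuP nu1 E_eigen.
  have [c2 c1] := scalar_ff_flat Uo sP PT PK TP LC PE PEN Mp Up vM
    erefl NN snu nuP nu1.
  exact: (four_formulas_hypersurface main ric dH dh c1 c2).
Qed.
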